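(* Let $V$ be a unitary vertex operator algebra of CFT type which is $C_2$-cofinite and such that every $\mathbb N$-gradable weak $V$-module is completely reducible. Let $W_i,W_j,W_k$ be unitary $V$-modules, $\mathcal Y_\alpha\in\mathcal V{k\choose i~j}$, and let $w^{(i)}\in W_i$ be homogeneous with $\mathcal Y_\alpha(w^{(i)},x)$ energy-bounded. Let $J$ be an open interval of $S^1$ contained in $S^1\setminus\{-1\}$. Choose $\varepsilon>0$ such that $\mathfrak r(t)J\subset S^1\setminus\{-1\}$ for any $t\in(-\varepsilon,\varepsilon)$. Then for any $g\in C^\infty_c(J)$ and $t\in(-\varepsilon,\varepsilon)$, the following equations hold when both sides act on $\mathcal H^\infty_j$: $$[\overline {L_0},\mathcal Y_\alpha(w^{(i)},g)]=\mathcal Y_\alpha\big(w^{(i)},(\Delta_{w^{(i)}}-1)g+ig'\big),$$ $$e^{it{\overline {L_0}}}\mathcal Y_\alpha(w^{(i)},g)e^{-it\overline {L_0}}=\mathcal Y_\alpha\big(w^{(i)},e^{i(\Delta_{w^{(i)}}-1)t}\mathfrak r(t)g\big).$$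
   Context: VOAs and modules. A VOA $V=\bigoplus_{n\in\mathbb Z}V(n)$ ($\dim V(n)<\infty$, $V(n)=0$ for $n\ll0$) has vertex operators $Y(u,x)=\sum_{n\in\mathbb Z}Y(u,n)x^{-n-1}$, vacuum $\Omega\in V(0)$, conformal vector $\nu\in V(2)$, with the usual axioms. CFT type: $V(0)=\mathbb C\Omega$, $V(n)=0$ for $n<0$. A $V$-module $W_i=\bigoplus_{s\in\mathbb R}W_i(s)$ ($\dim W_i(s)<\infty$, $W_i(s)=0$ for $s\ll0$) has a vertex operator $Y_i(v,x)=\sum_{n\in\mathbb Z}Y_i(v,n)x^{-n-1}$ with the usual axioms, $L_n=Y_i(\nu,n+1)$, $L_0=s$ on $W_i(s)$. A vector in $W_i(s)$ is homogeneous of weight $s$; $\Delta_w$ is the weight of $w$. $C_2$-cofinite: $\dim V/\mathrm{span}\{Y(u,-2)v\}<\infty$. An $\mathbb N$-gradable weak module is a space with vertex operator satisfying the module axioms except those on the $L_0$-grading, admitting a grading $\bigoplus_{n\in\mathbb N}W(n)$ with $Y(v,m)W(n)\subset W(n+\Delta_v-m-1)$. Unitarity. Inner products are antilinear in the second variable. $V$ is unitary if it has an inner product with $\langle\Omega|\Omega\rangle=1$ and an antilinear automorphism $\theta$ (fixing $\Omega,\nu$) such that $\langle Y(v,x)v_1|v_2\rangle=\langle v_1|Y(e^{xL_1}(-x^{-2})^{L_0}\theta v,x^{-1})v_2\rangle$. A $V$-module $W_i$ with an inner product is unitary if the same holds with $Y_i$. $\mathcal H_i$ is the Hilbert space completion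 of $W_i$; $L_0$ is essentially self-adjoint with positive closure $\overline{L_0}$; $\|\xi\|_r=\|(1+\overline{L_0})^r\xi\|$, $\mathcal H_i^\infty=\bigcap_{r\ge0}\mathscr D((1+\overline{L_0})^r)$. Intertwining operators. $\mathcal V{k\choose i~j}$ is the space of type $k\choose i~j$ intertwining operators: linear maps $w^{(i)}\in W_i\mapsto\mathcal Y_\alpha(w^{(i)},x)=\sum_{s\in\mathbb R}\mathcal Y_\alpha(w^{(i)},s)x^{-s-1}$, $\mathcal Y_\alpha(w^{(i)},s)\in\mathrm{Hom}(W_j,W_k)$, with lower truncation, $\frac d{dx}\mathcal Y_\alpha(w,x)=\mathcal Y_\alpha(L_{-1}w,x)$, and Jacobi identity $\sum_{l\ge0}{m\choose l}\mathcal Y_\alpha(Y_i(u,n+l)w,m+s-l)=\sum_{l\ge0}(-1)^l{n\choose l}Y_k(u,m+n-l)\mathcal Y_\alpha(w,s+l)-\sum_{l\ge0}(-1)^{l+n}{n\choose l}\mathcal Y_\alpha(w,n+s-l)Y_j(u,m+l)$. $\mathcal Y_\alpha(w^{(i)},x)$ is energy-bounded if there are $M,r,t\ge0$ with $\|\mathcal Y_\alpha(w^{(i)},s)w^{(j)}\|\le M(1+|s|)^t\|w^{(j)}\|_r$ for all $s\in\mathbb R,w^{(j)}\in W_j$. Smearing. An open interval of $S^1$ is $\{e^{it}:a<t<b\}$ with $a<b<a+2\pi$; $C_c^\infty(J)$ is the space of smooth functions on $S^1$ supported in $J$. For $g\in C_c^\infty(S^1\setminus\{-1\})$, $\mathcal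 Y_\alpha(w^{(i)},g)$ is defined by $\langle\mathcal Y_\alpha(w^{(i)},g)w^{(j)}|w^{(k)}\rangle=\int_{-\pi}^\pi\langle\mathcal Y_\alpha(w^{(i)},e^{i\theta})w^{(j)}|w^{(k)}\rangle g(e^{i\theta})\frac{e^{i\theta}}{2\pi}d\theta$ with $\arg e^{i\theta}=\theta$; it is a preclosed operator $W_j\to\mathcal H_k$ whose closure contains $\mathcal H_j^\infty$ in its domain and maps it into $\mathcal H_k^\infty$; $\mathcal Y_\alpha(w^{(i)},g):\mathcal H_j^\infty\to\mathcal H_k^\infty$ denotes the restriction of this closure. Rotations. $\mathfrak r(t)(e^{i\theta})=e^{i(\theta+t)}$ on $S^1$, $\mathfrak r(t)g=g\circ\mathfrak r(-t)$, and $g'(e^{i\theta})=\frac{d}{d\theta}g(e^{i\theta})$. *)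

(* Defs.v *)
From HB Require Import structures.
From mathcomp Require Import all_boot all_order all_algebra.
From mathcomp Require Import sesquilinear complex.
From mathcomp Require Import all_classical all_reals all_analysis.

Set Implicit Arguments.
Unset Strict Implicit.
Unset Printing Implicit Defensive.

Import Order.TTheory GRing.Theory Num.Theory.
Import numFieldNormedType.Exports.

Local Open Scope classical_set_scope.
Local Open Scope ring_scope.
Local Open Scope complex_scope.

Section LinearAlgebra.
Context (R : realType).
Local Notation C := R[i].

Definition subspace (U : lmodType C) (A : set U) : Prop :=
  A 0 /\ forall (a : C) u v, A u -> A v -> A (a *: u + v).

Definition lspan (U : lmodType C) (A : set U) : set U :=
  [set u | exists (n : nat) (c : 'I_n -> C) (a : 'I_n -> U),
     (forall i, A (a i)) /\ u = \sum_(i < n) c i *: a i].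

Definition finite_dim (U : lmodType C) (A : set U) : Prop :=
  exists (n : nat) (b : 'I_n -> U), A `<=` lspan (range b).

Definition finite_codim (U : lmodType C) (A : set U) : Prop :=
  exists (n : nat) (b : 'I_n -> U),
    forall u, exists2 v, lspan (range b) v & A (u - v).

Definition direct_sum (U : lmodType C) (I : choiceType) (A : I -> set U) :=
  [/\ forall i, subspace (A i),
      forall u, exists (s : seq I) (f : I -> U),
        (forall i, A i (f i)) /\ u = \sum_(i <- s) f i
    & forall (s : seq I) (f : I -> U), uniq s -> (forall i, A i (f i)) ->
        \sum_(i <- s) f i = 0 -> forall i, i \in s -> f i = 0].

(* the generalized binomial coefficient m(m-1)...(m-l+1)/l!, for m in Z *)
Definition binz (m : int) (l : nat) : C :=
  (\prod_(k < l) (m - k%:Z)%:~R) / l`!%:R.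

End LinearAlgebra.

Section VertexAlgebra.
Context (R : realType).
Local Notation C := R[i].

(* Modes of a vertex operator: Y u n is the coefficient of x^(-n-1), where n
   ranges over Z for modules and over R for intertwining operators. *)
Definition bilinear_modes (S : Type) (A B D : lmodType C)
    (Y : A -> S -> B -> D) : Prop :=
  (forall n b, linear (fun u => Y u n b)) /\ (forall u n, linear (Y u n)).

Definition lower_truncated (S : numDomainType) (A B D : lmodType C)
    (Y : A -> S -> B -> D) : Prop :=
  forall u b, exists N : S, forall n, N <= n -> Y u n b = 0.

(* The sums over l are finitely supported whenever the modes are lower
   truncated.  With S = int it is the Jacobi identity of a module (or of the
   algebra), with S = R that of an intertwining operator. *)
Definition jacobi (S : pzRingType) (V A B D : lmodType C)
    (YA : V -> int -> A -> A) (YB : V -> int -> B -> B)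
    (YD : V -> int -> D -> D) (Y : A -> S -> B -> D) : Prop :=
  forall (u : V) (w : A) (b : B) (m n : int) (s : S),
    \sum_(l \in [set: nat])
       binz R m l *: Y (YA u (n + l%:Z) w) (m%:~R + s - l%:R) b
  = \sum_(l \in [set: nat])
       ((-1) ^+ l * binz R n l) *: YD u (m + n - l%:Z) (Y w (s + l%:R) b)
    - \sum_(l \in [set: nat])
       ((-1) ^ (l%:Z + n) * binz R n l) *:
         Y w (n%:~R + s - l%:R) (YB u (m + l%:Z) b).

Record voa := Voa {
  voa_space :> lmodType C ;
  vwt : int -> set voa_space ;
  vop : voa_space -> int -> voa_space -> voa_space ;
  vac : voa_space ;
  conf : voa_space ;
  ccharge : C ;
  vwt_direct : direct_sum vwt ;
  vwt_finite : forall n, finite_dim (vwt n) ;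
  vwt_bounded : exists N : int, forall n, n < N -> vwt n `<=` [set 0] ;
  vop_bilinear : bilinear_modes vop ;
  vop_truncated : lower_truncated vop ;
  vac_conf_wt : vwt 0 vac /\ vwt 2 conf ;
  vop_vac : forall n v, vop vac n v = if n == -1 then v else 0 ;
  vop_creation : forall v, vop v (-1) vac = v /\
        forall n : int, 0 <= n -> vop v n vac = 0 ;
  vop_jacobi : jacobi vop vop vop vop ;
  vop_virasoro : forall (m n : int) v,
        vop conf (m + 1) (vop conf (n + 1) v)
        - vop conf (n + 1) (vop conf (m + 1) v)
      = (m - n)%:~R *: vop conf (m + n + 1) v
        + (if m + n == 0 then (m ^+ 3 - m)%:~R / 12%:R * ccharge else 0) *: v ;
  vop_L0 : forall n v, vwt n v -> vop conf 1 v = n%:~R *: v ;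
  vop_translation : forall u n v,
        vop (vop conf 0 u) n v = (- n)%:~R *: vop u (n - 1) v
}.

Definition cft_type (V : voa) : Prop :=
  vwt 0 = [set v : V | exists c : C, v = c *: vac V] /\
  forall n : int, n < 0 -> @vwt V n `<=` [set 0].

Definition C2_cofinite (V : voa) : Prop :=
  finite_codim (lspan [set x : V | exists u v, x = vop u (-2) v]).

Record weak_module (V : voa) := WeakModule {
  wm_space :> lmodType C ;
  mop : V -> int -> wm_space -> wm_space ;
  mop_bilinear : bilinear_modes mop ;
  mop_truncated : lower_truncated mop ;
  mop_vac : forall n w, mop (vac V) n w = if n == -1 then w else 0 ;
  mop_jacobi : jacobi (@vop V) mop mop mop
}.

Definition vir (V : voa) (W : weak_module V) (n : int) : W -> W :=
  @mop V W (conf V) (n + 1).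

Definition N_gradable (V : voa) (M : weak_module V) : Prop :=
  exists G : nat -> set M, direct_sum G /\
    forall (d : int) (v : V), vwt d v -> forall (m : int) (n : nat) (x : M),
      G n x ->
      match n%:Z + d - m - 1 with
      | Posz p => G p (mop v m x)
      | Negz _ => mop v m x = 0
      end.

Definition submodule (V : voa) (M : weak_module V) (N : set M) : Prop :=
  subspace N /\ forall v n x, N x -> N (mop v n x).

Definition irreducible_submodule (V : voa) (M : weak_module V) (N : set M) :=
  [/\ submodule N, N <> [set 0]
    & forall N' : set M, submodule N' -> N' `<=` N ->
        N' = [set 0] \/ N' = N].

Definition completely_reducible (V : voa) (M : weak_module V) : Prop :=
  exists (I : choiceType) (N : I -> set M),
    (forall i, irreducible_submodule (N i)) /\ direct_sum N.

Record vmodule (V : voa) := VModule {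
  vm_weak :> weak_module V ;
  mwt : R -> set vm_weak ;
  mwt_direct : direct_sum mwt ;
  mwt_finite : forall s, finite_dim (mwt s) ;
  mwt_bounded : exists N : R, forall s, s < N -> mwt s `<=` [set 0] ;
  mwt_L0 : forall s w, mwt s w -> vir 0 w = s%:C *: w
}.

(* The coefficient of x^(-m-1) in
     <Y(v,x)w1|w2> = <w1|Y(e^(x L_1) (-x^-2)^(L_0) theta v, x^-1)w2>
   for v, hence theta v, of weight d: the right-hand side is the sum over l, n
   of (-1)^d / l! <w1|Y(L_1^l theta v, n)w2> x^(l - 2d + n + 1). *)
Definition invariant_form (V : voa) (theta : V -> V) (W : lmodType C)
    (Y : V -> int -> W -> W) (ip : {dot W for Num.conj}) : Prop :=
  forall (d : int) (v : V), vwt d v -> forall (m : int) (w1 w2 : W),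
    ip (Y v m w1) w2 =
    ip w1 (\sum_(l \in [set: nat]) ((-1) ^ d / l`!%:R) *:
             Y (iter l (vop (conf V) 2) (theta v)) (2 * d - m - 2 - l%:Z) w2).

Record unitary_voa := UnitaryVoa {
  uv_voa :> voa ;
  uv_ip : {dot uv_voa for Num.conj} ;
  uv_theta : uv_voa -> uv_voa ;
  uv_vac : uv_ip (vac uv_voa) (vac uv_voa) = 1 ;
  uv_theta_bij : bijective uv_theta ;
  uv_theta_antilinear : forall (a : C) u v,
        uv_theta (a *: u + v) = Num.conj a *: uv_theta u + uv_theta v ;
  uv_theta_vop : forall u n v,
        uv_theta (vop u n v) = vop (uv_theta u) n (uv_theta v) ;
  uv_theta_vac : uv_theta (vac uv_voa) = vac uv_voa ;
  uv_theta_conf : uv_theta (conf uv_voa) = conf uv_voa ;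
  uv_invariant : invariant_form uv_theta (@vop uv_voa) uv_ip
}.

Record unitary_module (V : unitary_voa) := UnitaryModule {
  um_mod :> vmodule V ;
  um_ip : {dot um_mod for Num.conj} ;
  um_invariant : invariant_form (@uv_theta V) (@mop V um_mod) um_ip
}.

Record intertwiner (V : voa) (Wi Wj Wk : vmodule V) := Intertwiner {
  iop :> Wi -> R -> Wj -> Wk ;
  iop_bilinear : bilinear_modes iop ;
  iop_truncated : lower_truncated iop ;
  iop_translation : forall w s b,
        iop (vir (-1) w) s b = (- s)%:C *: iop w (s - 1) b ;
  iop_jacobi : jacobi (@mop V Wi) (@mop V Wj) (@mop V Wk) iop
}.

End VertexAlgebra.

(* Unbounded operators from H to K are represented by their graphs, as subsets
   of H * K; [A (xi, zeta)] reads: xi is in the domain of A and A xi = zeta. *)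
Section Operators.
Context (R : realType).
Local Notation C := R[i].

Definition op_dom (H K : Type) (A : set (H * K)) : set H :=
  [set x | exists y, A (x, y)].

Definition op_comp (H K L : Type) (A : set (K * L)) (B : set (H * K)) :
    set (H * L) :=
  [set p | exists y, B (p.1, y) /\ A (y, p.2)].

Definition op_sub (H : Type) (K : zmodType) (A B : set (H * K)) :
    set (H * K) :=
  [set p | exists y z, [/\ A (p.1, y), B (p.1, z) & p.2 = y - z]].

(* A and B are both defined on D, single-valued there, and coincide on D *)
Definition eq_on (H K : Type) (D : set H) (A B : set (H * K)) : Prop :=
  forall x, D x -> exists y,
    [set z | A (x, z)] = [set y] /\ [set z | B (x, z)] = [set y].

Definition op_val (H : Type) (K : nmodType) (A : set (H * K)) (x : H) : K :=
  xget 0 [set y | A (x, y)].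

(* The function f(T) of a self-adjoint operator T whose eigenvectors span a
   dense subspace (as is the case of the closure of L_0, by density of the
   weight vectors): f(T) is the closed operator which has the linear span of
   the eigenvectors as a core and is multiplication by f(l) on the eigenspace
   of l, i.e. f(T) x = \sum_l f(l) P_l x on the x such that
   \sum_l |f(l)|^2 |P_l x|^2 is finite, P_l being the spectral projections. *)
Definition op_fun (H : normedModType C) (T : set (H * H)) (f : R -> C) :
    set (H * H) :=
  closure (lspan [set p : H * H |
    exists l : R, T (p.1, l%:C *: p.1) /\ p.2 = f l *: p.1]).

Record hilbert_completion (W : lmodType C) (ip : {dot W for Num.conj}) :=
  HilbertCompletion {
  hc_space :> completeNormedModType C ;
  hc_ip : {dot hc_space for Num.conj} ;
  hc_in : {linear W -> hc_space} ;
  hc_norm : forall x, `|x| ^+ 2 = hc_ip x x ;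
  hc_isometry : forall u v, hc_ip (hc_in u) (hc_in v) = ip u v ;
  hc_dense : dense (range hc_in)
}.

End Operators.

Section Circle.
Context (R : realType).
Local Notation C := R[i].

Definition cis (x : R) : C := cos x +i* sin x.

Definition circle : set C^o := [set z | `|z| = 1].
Definition S1 : Type := set_type circle.

Lemma cis_norm (x : R) : `|cis x| = 1.
Proof. by rewrite normc_def /= cos2Dsin2 sqrtr1. Qed.

Lemma cis_circle (x : R) : (cis x : C^o) \in circle.
Proof. by apply/mem_set; exact: cis_norm. Qed.

Definition e_i (x : R) : S1 := exist (fun z => z \in circle) _ (cis_circle x).

Lemma rotS1_norm (t : R) (z : S1) :
  (cis t * \val z : C^o) \in circle.
Proof.
case: z => z zn; apply/mem_set; rewrite /circle /=.
transitivity (`|cis t| * `|z : C|); first exact: normrM.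
by rewrite cis_norm mul1r; exact: set_mem zn.
Qed.

Definition rotS1 (t : R) (z : S1) : S1 :=
  exist (fun z => z \in circle) _ (rotS1_norm t z).

Definition rot_fun (t : R) (g : S1 -> C) : S1 -> C := fun z => g (rotS1 (- t) z).

Definition smooth (f : R -> R) : Prop :=
  forall (n : nat) (x : R), derivable (derive1n n f) x 1.

(* C_c^oo(J): smooth functions on the circle with (closed) support in J *)
Definition test_fun (J : set S1) (g : S1 -> C) : Prop :=
  [/\ smooth (fun x => complex.Re (g (e_i x))),
      smooth (fun x => complex.Im (g (e_i x)))
    & closure [set z | g z != 0] `<=` J].

(* g'(e^(i x)) = d/dx g(e^(i x)) *)
Definition dS1 (g : S1 -> C) (z : S1) : C :=
  derive1 (fun t => complex.Re (g (rotS1 t z))) 0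
  +i* derive1 (fun t => complex.Im (g (rotS1 t z))) 0.

Definition open_arc (J : set S1) : Prop :=
  exists a b : R, [/\ a < b, b < a + 2 * pi & J = e_i @` `]a, b[].

Definition cut_circle : set S1 := [set z | \val z != -1 :> C].

Definition cintegral (a b : R) (f : R -> C) : C :=
  (\int[lebesgue_measure]_(x in `[a, b]) complex.Re (f x))
  +i* (\int[lebesgue_measure]_(x in `[a, b]) complex.Im (f x)).

End Circle.

Section SmoothVectors.
Context (R : realType) (V : unitary_voa R).
Local Notation C := R[i].

Definition completion (W : unitary_module V) := hilbert_completion (um_ip W).

Definition L0cl (W : unitary_module V) (H : completion W) : set (H * H) :=
  closure [set p | exists w : W, p = (hc_in H w, hc_in H (vir 0 w))].
Arguments L0cl {W} H _.

Definition L0pow (W : unitary_module V) (H : completion W) (r : R) :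
    set (H * H) :=
  op_fun (L0cl H) (fun l => ((1 + l) `^ r)%:C).
Arguments L0pow {W} H r _.

Definition L0exp (W : unitary_module V) (H : completion W) (t : R) :
    set (H * H) :=
  op_fun (L0cl H) (fun l => cis (t * l)).

Definition smooth_vectors (W : unitary_module V) (H : completion W) : set H :=
  [set x | forall r : R, 0 <= r -> op_dom (L0pow H r) x].

(* Only meaningful on the domain of (1 + L_0)^r, which contains W. *)
Definition sobolev_norm (W : unitary_module V) (H : completion W) (r : R)
    (x : H) : C := `|op_val (L0pow H r) x|.

End SmoothVectors.

Arguments L0cl {R V W} H _.
Arguments L0pow {R V W} H r _.
Arguments L0exp {R V W} H t _.
Arguments smooth_vectors {R V W} H _.
Arguments sobolev_norm {R V W} H r x.

Section Smearing.
Context (R : realType) (V : unitary_voa R).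
Local Notation C := R[i].
Context (Wi Wj Wk : unitary_module V) (Y : intertwiner Wi Wj Wk).
Context (Hj : completion Wj) (Hk : completion Wk).

Definition energy_bounded (w : Wi) : Prop :=
  exists M r t : R, [/\ 0 <= M, 0 <= r, 0 <= t &
    forall (s : R) (wj : Wj),
      `|hc_in Hk (Y w s wj)| <=
        (M * (1 + `|s|) `^ t)%:C * sobolev_norm Hj r (hc_in Hj wj)].

(* <Y(w, e^(i x))wj|wk>, with arg e^(i x) = x; the sum is finitely supported *)
Definition correlation (w : Wi) (wj : Wj) (wk : Wk) (x : R) : C :=
  \sum_(s \in [set: R]) um_ip Wk (Y w s wj) wk * cis (x * (- s - 1)).

Definition smeared_alg (w : Wi) (g : S1 R -> C) : set (Hj * Hk) :=
  [set p | exists wj : Wj, p.1 = hc_in Hj wj /\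
    forall wk : Wk, hc_ip Hk p.2 (hc_in Hk wk) =
      cintegral (- pi) pi (fun x =>
        correlation w wj wk x * g (e_i x) * (cis x / (2 * pi)%:C))].

Definition smeared (w : Wi) (g : S1 R -> C) : set (Hj * Hk) :=
  [set p | [/\ closure (smeared_alg w g) p,
      smooth_vectors Hj p.1 & smooth_vectors Hk p.2]].

End Smearing.

Arguments smeared {R V Wi Wj Wk} Y Hj Hk w g _.

(* Main.v *)
(* Everything is reduced to matrix entries between weight vectors.  For v of
   weight la and u of weight mu, only the mode s = la + Delta - 1 - mu
   contributes, so <Y(w,g)v|u> = \hat g(s) <Y(w,s)v|u>, where \hat g(s) is the
   integral of g(e^(ix)) e^(-isx) / 2pi.  Both identities then amount to
     \hat{g1}(s) = (Delta - 1 - s) \hat g(s) = (mu - la) \hat g(s),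
     \hat{gt}(s) = e^(it(Delta - 1 - s)) \hat g(s) = e^(it(mu - la)) \hat g(s),
   which are an integration by parts and a translation; the latter does not
   cross the cut because the rotated arcs avoid -1.

   The analysis consists in extending this from W_j to the smooth vectors.
   Since \hat g is rapidly decreasing and s is controlled by la and mu, the
   energy bounds make the matrix decay faster than any power of one weight, up
   to a power of the other.  Series over the weights then converge, provided
   that the weights lie in finitely many cosets of Z; this produces adjoint
   vectors a(u) with <Y(w,g)x|u> = <x|a(u)>, hence closability, and the images
   of smooth vectors.

   Finiteness of the number of cosets follows from complete reducibility alone.
   The graded product of the components of W_j indexed by the cosets is an
   N-gradable weak module, so a vector with a nonzero lowest weight component
   at every coset lies in a finite sum of irreducible submodules, and each of
   these is contained in the component of a single coset. *)

Require Import Defs.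
From HB Require Import structures.
From mathcomp Require Import all_boot all_order all_algebra.
From mathcomp Require Import sesquilinear complex ring lra zify.
From mathcomp Require Import all_classical all_reals all_analysis.

Set Implicit Arguments.
Unset Strict Implicit.
Unset Printing Implicit Defensive.

Import Order.TTheory GRing.Theory Num.Theory.
Import numFieldNormedType.Exports.

Local Open Scope classical_set_scope.
Local Open Scope ring_scope.
Local Open Scope complex_scope.

(** * Linear maps, finitely supported sums and generalized binomial coefficients *)

Section LinearMaps.
Variables (K : pzRingType) (U W : lmodType K) (f : U -> W).
Hypothesis f_lin : linear f.

Lemma lin0 : f 0 = 0.
Proof. by have := f_lin (-1) 0 0; rewrite scaler0 addr0 scaleN1r addNr. Qed.

Lemma linZ a u : f (a *: u) = a *: f u.
Proof. by have := f_lin a u 0; rewrite !addr0 lin0 addr0. Qed.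

Lemma linD u v : f (u + v) = f u + f v.
Proof. by have := f_lin 1 u v; rewrite !scale1r. Qed.

Lemma lin_sum (I : Type) (s : seq I) (P : pred I) (F : I -> U) :
  f (\sum_(i <- s | P i) F i) = \sum_(i <- s | P i) f (F i).
Proof. exact: (big_morph f linD lin0). Qed.

End LinearMaps.

Lemma fsum_nat (U : nmodType) (F : nat -> U) (n : nat) :
  (forall l, (n <= l)%N -> F l = 0) ->
  \sum_(l \in [set: nat]) F l = \sum_(l < n) F l.
Proof.
move=> F0; rewrite fsbig_ord; apply/esym/fsbig_widen => // l /= [_ /negP].
by rewrite -leqNgt => /F0.
Qed.

Lemma fsum_pick (U : nmodType) (T : choiceType) (F : T -> U) (i : T) :
  (forall j, j != i -> F j = 0) -> \sum_(j \in [set: T]) F j = F i.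
Proof.
move=> F0; transitivity (\sum_(j \in [set i]) F j); last by rewrite fsbig_set1.
by apply/esym/fsbig_widen => // j /= [_] /eqP /F0.
Qed.

Section BinomialCoefficients.
Variable R : realType.

Lemma binzn0 (m : int) : binz R m 0 = 1.
Proof. by rewrite /binz big_ord0 fact0 divr1. Qed.

Lemma binz_nat (m l : nat) : (m < l)%N -> binz R m%:Z l = 0.
Proof.
move=> ml; rewrite /binz (bigD1 (Ordinal ml)) //= subrr mul0r.
by rewrite mul0r.
Qed.

Lemma binz1 (m : int) : binz R m 1 = m%:~R.
Proof. by rewrite /binz big_ord1 subr0 divr1. Qed.

(** These coefficients enter the Jacobi identity at [n = -2], which [mop_translation] uses. *)
Lemma binzN2 (l : nat) : binz R (- 2) l = (-1) ^+ l * l.+1%:R.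
Proof.
rewrite /binz.
suff -> : \prod_(k < l) (- 2 - k%:Z)%:~R = (-1) ^+ l * (l.+1)`!%:R :> R[i].
  by rewrite -mulrA factS natrM mulfK // pnatr_eq0 -lt0n fact_gt0.
elim: l => [|l IHl]; first by rewrite big_ord0 expr0 mulr1.
rewrite big_ord_recr /= IHl exprSr (factS l.+1) natrM.
have -> : - 2 - l%:Z = - l.+2%:Z by lia.
rewrite mulrNz; ring.
Qed.

Lemma binz2 : binz R 2 2 = 1.
Proof.
by rewrite /binz !big_ord_recl big_ord0 /= -[_ * (_ * _)]/(2 * (1 * 1)) !mulr1
  divff // pnatr_eq0.
Qed.

End BinomialCoefficients.

Section ModuleModes.
Context (R : realType) (V : voa R).
Local Notation C := R[i].

(** Translation at mode -1 on the vacuum. Modes of L_{-1}u on a module thereby become accessible to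
    the Jacobi identity of u with the vacuum. *)
Lemma conf0_vac (u : V) : vop (conf V) 0 u = vop u (- 2) (vac V).
Proof.
have := @vop_translation _ V u (-1) (vac V).
by rewrite (vop_creation _).1 opprK scale1r.
Qed.

(** The conformal vector is L_{-2} of the vacuum, and [L_1, L_{-2}] = 3 L_{-1}, where both L_1 and
    L_{-1} kill the vacuum. Being quasi-primary is what gives L_n the adjoint L_{-n}. *)
Lemma conf2_conf : vop (conf V) 2 (conf V) = 0.
Proof.
have /= := @vop_virasoro _ V 1 (-2) (vac V).
rewrite (vop_creation (conf V)).1 (vop_creation (conf V)).2 //.
have -> : 1 + -2 + 1 = 0 :> int by [].
rewrite (vop_creation (conf V)).2 // scaler0 add0r scale0r.
by rewrite (lin0 ((vop_bilinear V).2 _ _)) subr0.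
Qed.

Variable W : weak_module V.

Lemma mopl v n : linear (fun u : V => @mop _ V W u n v).
Proof. exact: (mop_bilinear W).1. Qed.

Lemma mopr (u : V) n : linear (@mop _ V W u n).
Proof. exact: (mop_bilinear W).2. Qed.


End ModuleModes.

(** * Weights and the commutator formula *)

(** This is the Jacobi identity at [n = 0]: the binomials of 0 leave one term in each sum on the
    right, and those of the natural number [m] truncate the left. *)
Lemma jacobi_comm (R : realType) (S : pzRingType) (V A B D : lmodType R[i])
    (YA : V -> int -> A -> A) (YB : V -> int -> B -> B) (YD : V -> int -> D ->
      D)
    (Y : A -> S -> B -> D) (u : V) (w : A) (b : B) (m : nat) (s : S) :
  jacobi YA YB YD Y ->
  YD u m%:Z (Y w s b) - Y w s (YB u m%:Z b) =
  \sum_(l < m.+1) binz R m l *: Y (YA u l w) (m%:R + s - l%:R) b.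
Proof.
move=> /(_ u w b m%:Z 0 s) J.
rewrite (@fsum_nat _ _ m.+1) in J; last first.
  by move=> l lm; rewrite binz_nat // scale0r.
have b0 l : l != 0%N -> binz R 0 l = 0.
  by move=> l0; rewrite (@binz_nat R 0) // lt0n.
rewrite 2?(fsum_pick (i := 0%N)) in J; last first.
- by move=> j j0; rewrite b0 // mulr0 scale0r.
- by move=> j j0; rewrite b0 // mulr0 scale0r.
move: J; rewrite -[0%:Z]/(0 : int) !addr0 !add0r expr0 expr0z binzn0 !mulr1
  !scale1r !subr0 => J.
by rewrite -J; apply: eq_bigr => l _; rewrite add0r.
Qed.

Section ModuleWeights.
Context (R : realType) (V : voa R).
Local Notation C := R[i].

(** Jacobi identity for u and the vacuum with indices 0, -2, n. Only the mode -1 of the vacuum is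
    nonzero, so the first sum has a term just for n < 0 and the second just for n > 0. *)
Lemma mop_translation (W : weak_module V) (u : V) (n : int) (b : W) :
  mop (vop (conf V) 0 u) n b = (- n)%:~R *: mop u (n - 1) b.
Proof.
rewrite conf0_vac.
have := @mop_jacobi _ V W u (vac V) b 0 (-2) n.
rewrite (fsum_pick (i := 0%N)) => [|l l0]; last first.
  by rewrite (@binz_nat R 0) ?scale0r // lt0n.
rewrite binzn0 scale1r -[0%:Z]/(0 : int) addr0 add0r subr0 => ->.
have vac0 k x : k != -1 -> mop (vac V) k x = 0 :> W.
  by move=> k1; rewrite mop_vac (negbTE k1).
have -> : \sum_(l \in [set: nat]) ((-1) ^+ l * binz R (- 2) l) *:
    mop u (0 + - 2 - l%:Z) (mop (vac V) (n + l%:R) b) =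
    (if n is Negz k then k.+1%:R *: mop u (n - 1) b else 0).
  case: n => [k|k].
    rewrite fsbig1 // => l _; rewrite vac0 ?(lin0 (mopr _ _)) ?scaler0 //.
    by lia.
  rewrite (fsum_pick (i := k)) => [|l lk].
    rewrite binzN2 mulrA -exprMn mulrNN mulr1 expr1n mul1r.
    rewrite mop_vac ifT; last by lia.
    by congr (_ *: mop _ _ _); lia.
  by rewrite vac0 ?(lin0 (mopr _ _)) ?scaler0 //; lia.
have -> : \sum_(l \in [set: nat]) ((-1) ^ (l%:Z + - 2) * binz R (- 2) l) *:
    mop (vac V) ((- 2)%:~R + n - l%:R) (mop u (0 + l%:Z) b) =
    (if n is Posz k then k%:R *: mop u (n - 1) b else 0).
  case: n => [[|k]|k].
  - rewrite scale0r fsbig1 // => l _; rewrite vac0 ?scaler0 //.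
    by lia.
  - rewrite (fsum_pick (i := k)) => [|l lk].
      have -> : (-1) ^ (k%:Z + -2) = (-1) ^+ k :> C.
        rewrite expfzDr ?oppr_eq0 ?oner_eq0 //.
        by rewrite -exprz_inv invrN1 -[(-1) ^ 2]/((-1) ^+ 2) sqrrN expr1n mulr1.
      rewrite binzN2 mulrA -exprMn mulrNN mulr1 expr1n mul1r.
      rewrite mop_vac ifT; last by lia.
      by congr (_ *: mop _ _ _); lia.
    by rewrite vac0 ?scaler0 //; lia.
  - rewrite fsbig1 // => l _; rewrite vac0 ?scaler0 //.
    by lia.
case: n => k; last by rewrite subr0.
by rewrite sub0r -scaleNr mulrNz.
Qed.
Lemma vir0_mop (W : weak_module V) (d : int) (v : V) (n : int) (b : W) :
  vwt d v ->
  vir 0 (mop v n b) = mop v n (vir 0 b) + (d - n - 1)%:~R *: mop v n b.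
Proof.
move=> vd.
have := jacobi_comm (conf V) v b 1 n (@mop_jacobi _ V W).
rewrite !big_ord_recr big_ord0 /= !add0r binzn0 binz1 !scale1r subr0.
rewrite -[1%R]/(1%:Z) (vop_L0 vd) mop_translation (linZ (mopl _ _)).
rewrite -[1%:R]/(1%:Z) (addrC 1%:Z n) addrK -scalerDl -intrD.
have -> : - (n + 1) + d = d - n - 1 by lia.
by move/(canRL (subrK _)); rewrite addrC.
Qed.

(** Commutator formula at [m = 2] for the conformal vector with itself: the three terms involve
    L_{-1}, L_0 and L_1 of that vector, the last of which is 0. *)
Lemma vir1_virN1 (W : weak_module V) (b : W) :
  vir 1 (vir (-1) b) - vir (-1) (vir 1 b) = 2 *: vir 0 b.
Proof.
have := jacobi_comm (conf V) (conf V) b 2 0 (@mop_jacobi _ V W).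
rewrite !big_ord_recr big_ord0 /= !add0r binzn0 binz1 binz2 !scale1r.
have -> : vop (conf V) 1%:Z (conf V) = 2%:~R *: conf V.
  exact: (vop_L0 (vac_conf_wt V).2).
rewrite conf2_conf (lin0 (mopl _ _)) addr0 mop_translation (linZ (mopl _ _)).
rewrite scalerA -scalerDl /vir => ->; congr (_ *: _).
by rewrite -intrM -intrD.
Qed.

Section GradedDecomposition.
Variables (U : lmodType C) (I : choiceType) (A : I -> set U).
Hypothesis A_direct : direct_sum A.

Let A_sub i : Defs.subspace (A i). Proof. by have [As _ _] := A_direct;
  exact: As. Qed.

Lemma dsum0 i : A i 0. Proof. exact: (A_sub i).1. Qed.

Lemma dsumD i u v : A i u -> A i v -> A i (u + v).
Proof. by rewrite -{2}[u]scale1r; exact: (A_sub i).2. Qed.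

Lemma dsumZ i a u : A i u -> A i (a *: u).
Proof. by rewrite -[_ *: _]addr0 => Au; apply: (A_sub i).2 => //;
  exact: dsum0. Qed.

Lemma dsumMn i u n : A i u -> A i (u *+ n).
Proof. by rewrite -scaler_nat; exact: dsumZ. Qed.

(** [direct_sum] lets an index occur several times in a decomposition; repetitions are absorbed as
    multiplicities. *)
Lemma dsum_uniq (u : U) : exists (s : seq I) (f : I -> U),
  [/\ uniq s, forall i, A i (f i) & u = \sum_(i <- s) f i].
Proof.
have [_ /(_ u) [s [f [Af ->]]] _] := A_direct.
exists (undup s), (fun i => f i *+ count_mem i s); split;
  first exact: undup_uniq.
  by move=> i; exact: dsumMn.
rewrite -big_undup_iterop_count; apply: eq_bigr => i _.
by rewrite Monoid.iteropE iter_addr addr0.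
Qed.

Lemma dsum_ind (P : U -> Prop) :
  P 0 -> (forall u v, P u -> P v -> P (u + v)) -> (forall i u, A i u -> P u) ->
  forall u, P u.
Proof.
move=> P0 PD PA u; have [s [f [_ Af ->]]] := dsum_uniq u.
by apply: big_ind => // i _; exact: PA (Af i).
Qed.

End GradedDecomposition.

Lemma vwt_ind (P : V -> Prop) :
  P 0 -> (forall u v, P u -> P v -> P (u + v)) ->
  (forall (d : int) u, vwt d u -> P u) -> forall u, P u.
Proof. by move=> P0 PD PA; exact: (dsum_ind (vwt_direct V)). Qed.

Lemma mwt_ind (W : vmodule V) (P : W -> Prop) :
  P 0 -> (forall u v, P u -> P v -> P (u + v)) ->
  (forall (s : R) u, mwt s u -> P u) -> forall u, P u.
Proof. by move=> P0 PD PA; exact: (dsum_ind (mwt_direct W)). Qed.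

Lemma mwtZ (W : vmodule V) (s : R) (a : C) (u : W) : mwt s u -> mwt s (a *: u).
Proof. by move=> us; apply: (dsumZ (mwt_direct W)). Qed.

Lemma mwtD (W : vmodule V) (s : R) (u v : W) :
  mwt s u -> mwt s v -> mwt s (u + v).
Proof. by move=> us vs; apply: (dsumD (mwt_direct W)). Qed.

Lemma mwt0 (W : vmodule V) (s : R) : @mwt _ _ W s 0.
Proof. exact: (dsum0 (mwt_direct W)). Qed.

(** Applying L_0 - s to the weight decomposition multiplies the component of weight i by i - s, so
    independence kills every component with i different from s. *)
Lemma mwt_eigen (W : vmodule V) (s : R) (u : W) :
  vir 0 u = s%:C *: u -> mwt s u.
Proof.
have [l [f [l_uniq fw ->]]] := dsum_uniq (mwt_direct W) u => us.
have f0 i : i \in l -> i != s -> f i = 0.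
  move=> il iNs; have [_ _ /(_ l (fun i => (i - s)%:C *: f i) l_uniq)] :=
    mwt_direct W.
  have fw' j : mwt j ((j - s)%:C *: f j) by apply: dsumZ (mwt_direct W) _ _ _
    (fw j).
  move=> /(_ fw'); have -> : \sum_(j <- l) (j - s)%:C *: f j = 0.
    have: vir 0 (\sum_(i <- l) f i) - s%:C *: \sum_(i <- l) f i = 0 by rewrite
      us subrr.
    rewrite /vir (lin_sum (mopr _ _)) scaler_sumr -sumrB => e; rewrite -[RHS]e.
    by apply: eq_bigr => j _; rewrite rmorphB scalerBl -(mwt_L0 (fw j)).
  move=> /(_ erefl i il) /eqP; rewrite scaler_eq0 => /orP [|/eqP //].
  by rewrite fmorph_eq0 subr_eq0 (negbTE iNs).
rewrite big_seq; apply: (big_ind (@mwt _ _ W s)).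
- exact: dsum0 (mwt_direct W) s.
- by move=> x y; exact: mwtD.
- move=> i il; have [<- //|/(f0 i il) ->] := eqVneq i s.
  exact: dsum0 (mwt_direct W) s.
Qed.

Lemma vir_lin (W : weak_module V) (n : int) : linear (@vir _ V W n).
Proof. exact: mopr. Qed.

Lemma mwt_mop (W : vmodule V) (d : int) (v : V) (n : int) (s : R) (b : W) :
  vwt d v -> mwt s b -> mwt (s + (d - n - 1)%:~R) (mop v n b).
Proof.
move=> vd bs; apply: mwt_eigen.
rewrite (vir0_mop _ _ vd) (mwt_L0 bs) (linZ (mopr _ _)) -scalerDl.
by rewrite (rmorphD (real_complex R)) (rmorph_int (real_complex R)).
Qed.

(** In the commutator of L_0 with the mode s, the term of L_{-1}w contributes -(s + 1) and that of
    L_0 w contributes [D]. *)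
Lemma mwt_iop (Wi Wj Wk : vmodule V) (Y : intertwiner Wi Wj Wk) (D s r : R)
    (w : Wi) (b : Wj) :
  mwt D w -> mwt r b -> mwt (r + D - 1 - s) (Y w s b).
Proof.
move=> wD br; apply: mwt_eigen.
have := jacobi_comm (conf V) w b 1 s (@iop_jacobi _ V _ _ _ Y).
rewrite !big_ord_recr big_ord0 /= !add0r binzn0 binz1 !scale1r subr0.
have := mwt_L0 wD; rewrite /vir -[0 + 1]/(1%:Z) => ->.
have := mwt_L0 br; rewrite /vir -[0 + 1]/(1%:Z) => ->.
have := iop_translation Y w (1 + s) b; rewrite /vir -[-1 + 1]/(0%:Z) => ->.
have -> : 1 + s - 1 = s by rewrite addrC addKr.
rewrite (linZ ((iop_bilinear Y).2 _ _)) (linZ ((iop_bilinear Y).1 _ _)).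
rewrite -scalerDl => /(canRL (subrK _)) ->; rewrite -scalerDl.
rewrite -!(rmorphD (real_complex R)); congr (_ *: _); congr (_%:C); ring.
Qed.

Lemma mwt_below (W : vmodule V) : exists N : R, forall s (u : W),
  mwt s u -> s < N -> u = 0.
Proof. by have [N N0] := mwt_bounded W; exists N => s u us /N0; apply. Qed.

End ModuleWeights.

(** * Adjoints, orthogonality and positivity of weights in unitary modules *)

Section UnitaryWeights.
Context (R : realType) (V : unitary_voa R) (W : unitary_module V).
Local Notation C := R[i].

(** The conformal vector has even weight, is fixed by theta and is killed by L_1, so only the term
    [l = 0] of the invariance sum survives, with sign +1. *)
Lemma vir_adjoint (n : int) (u v : W) :
  um_ip W (vir n u) v = um_ip W u (vir (- n) v).
Proof.
have /= := um_invariant (vac_conf_wt V).2 (n + 1) u v.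
rewrite (fsum_pick (i := 0%N)) => [|l l0].
  rewrite /= uv_theta_conf fact0 divr1 -[(-1) ^ 2]/((-1) ^+ 2) sqrrN expr1n
    scale1r.
  have -> : 2 * 2 - (n + 1) - 2 - 0%:Z = - n + 1 by lia.
  by [].
rewrite uv_theta_conf; case: l l0 => // l _; rewrite iterSr conf2_conf.
rewrite iter_fix ?(lin0 ((vop_bilinear V).2 _ _)) //.
by rewrite (lin0 (mopl _ _)) scaler0.
Qed.

Lemma mwt_orth (s r : R) (u v : W) :
  mwt s u -> mwt r v -> s != r -> um_ip W u v = 0.
Proof.
move=> us vr sr; have := vir_adjoint 0 u v.
rewrite oppr0 (mwt_L0 us) (mwt_L0 vr) linearZl_LR linearZr_LR /=.
rewrite -[Num.conj _]/((r%:C)^*)%C conjc_real => /eqP.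
rewrite -subr_eq0 -mulrBl -(rmorphB (real_complex R)) mulf_eq0 fmorph_eq0.
by rewrite subr_eq0 (negbTE sr) => /eqP.
Qed.

(** Induction on the distance to the lower bound of the weights. If L_1 u is nonzero, its weight s -
    1 is already nonnegative; otherwise the squared norm of L_{-1}u equals 2s times that of u. *)
Lemma mwt_ge0 (s : R) (u : W) : mwt s u -> u != 0 -> 0 <= s.
Proof.
have [N W0] := mwt_below W.
move=> us u0; have [k sk] : exists k : nat, s < N + k%:R.
  exists (Num.truncn (s - N)).+1; rewrite -ltrBlDl; exact: truncnS_gt.
elim: k s u us u0 sk => [s u us u0|k IHk s u us u0 sk].
  by rewrite addr0 => /(W0 _ _ us)/eqP; rewrite (negbTE u0).
have u1 : mwt (s - 1) (vir 1 u).
  have /= := mwt_mop (1 + 1) (vac_conf_wt V).2 us.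
  by rewrite -[X in X%:~R]/(-1 : int) mulrN1z.
have [u10|u10] := eqVneq (vir 1 u) 0; last first.
  have : 0 <= s - 1 by apply: IHk u1 u10 _; move: sk; rewrite -natr1; lra.
  by lra.
have := dnorm_ge0 (um_ip W) (vir (-1) u).
rewrite vir_adjoint opprK; have := vir1_virN1 u.
rewrite u10 (lin0 (vir_lin _)) subr0 => ->.
have -> : 2 *: vir 0 u = (2 * s)%:C *: u.
  by rewrite (mwt_L0 us) scalerA (rmorphM (real_complex R)) (rmorph_nat
    (real_complex R)).
rewrite linearZr_LR /= -[Num.conj _]/(((2 * s)%:C)^*)%C conjc_real.
rewrite pmulr_lge0 ?dnorm_gt0 // -[0]/(0%:C) lecR.
by lra.
Qed.

End UnitaryWeights.

(** * Finiteness of the set of weights modulo the integers *)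

Section GradedProduct.
Context (R : realType) (V : unitary_voa R) (W : unitary_module V).
Local Notation C := R[i].

(* One element for each coset of Z that meets the set of weights. *)
Definition minw : set R := [set h |
  (exists2 u : W, mwt h u & u != 0) /\
  forall (k : nat) (u : W), mwt (h - k.+1%:R) u -> u = 0].

Definition gsum (h : R) (P : nat) : set W := [set u | exists s : seq W,
  (forall x, x \in s -> exists2 n, (n < P)%N & mwt (h + n%:R) x) /\
  u = \sum_(x <- s) x].

Lemma gsum0 h P : gsum h P 0.
Proof. by exists [::]; rewrite big_nil. Qed.

Lemma gsumD h P u v : gsum h P u -> gsum h P v -> gsum h P (u + v).
Proof.
move=> [s [sP ->]] [r [rP ->]]; exists (s ++ r); rewrite big_cat; split => // x.
by rewrite mem_cat => /orP [/sP|/rP].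
Qed.

Lemma gsum_le h P Q u : (P <= Q)%N -> gsum h P u -> gsum h Q u.
Proof.
move=> PQ [s [sP ->]]; exists s; split => // x /sP [n nP xn].
by exists n => //; exact: leq_trans nP PQ.
Qed.

Lemma gsumZ h P a u : gsum h P u -> gsum h P (a *: u).
Proof.
move=> [s [sP ->]]; exists [seq a *: x | x <- s].
rewrite big_map scaler_sumr; split => // _ /mapP [x /sP [n nP xn] ->].
by exists n => //; exact: mwtZ.
Qed.

Lemma gsum_comp h P u : gsum h P u -> exists f : nat -> W,
  [/\ forall n, mwt (h + n%:R) (f n), forall n, (P <= n)%N -> f n = 0
    & u = \sum_(n < P) f n].
Proof.
move=> [s []]; elim: s u => [|x s IHs] u sP ->.
  exists (fun=> 0); rewrite big_nil big1 //; split => // n; exact: mwt0.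
have [n nP xn] := sP x (mem_head _ _).
have [|f [fw f0 fs]] := IHs _ _ erefl.
  by move=> y ys; apply: sP; rewrite inE ys orbT.
exists (fun k => f k + (if k == n then x else 0)); split.
- by move=> k; apply: mwtD => //; case: eqP => [->//|_]; exact: mwt0.
- by move=> k Pk; rewrite f0 // add0r ifF //; apply/eqP => kn; lia.
- rewrite big_cons fs big_split /= addrC; congr (_ + _).
  rewrite (bigD1 (Ordinal nP)) //= eqxx big1 ?addr0 // => i.
  by rewrite -val_eqE /= => /negbTE ->.
Qed.

Lemma minw_shift h (P : nat) (e : int) (x : W) (m : nat) : minw h ->
  (m < P)%N ->
  mwt (h + m%:R + e%:~R) x ->
  exists2 n, (n < (P + `|e|).+1)%N & mwt (h + n%:R) x.
Proof.
move=> [_ h0] mP xw.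
move: xw; rewrite -addrA -[m%:R]/(m%:Z%:~R) -intrD.
case E : (m%:Z + e) => [k|k] xk; first by exists k => //; lia.
(* A weight below [h] in its coset carries only the zero vector, which may be given degree 0. *)
by exists 0%N; rewrite // (h0 k x xk); exact: mwt0.
Qed.

(** The point is that [Q] does not depend on [h]: a homogeneous v shifts degrees by an integer that
    is the same in all cosets. *)
Lemma gsum_mop (v : V) (n : int) (P : nat) : exists Q, forall h u, minw h ->
  gsum h P u -> gsum h Q (mop v n u).
Proof.
elim/vwt_ind: v.
- exists 0%N => h u _ _; rewrite (lin0 (mopl _ _)); exact: gsum0.
- move=> u1 u2 [Q1 H1] [Q2 H2]; exists (maxn Q1 Q2) => h u hm uP.
  rewrite (linD (mopl _ _)); apply: gsumD.
    by apply: gsum_le (H1 _ _ hm uP); rewrite leq_maxl.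
  by apply: gsum_le (H2 _ _ hm uP); rewrite leq_maxr.
- move=> d u1 u1d; exists (P + `|(d - n - 1)%R|).+1 => h u hm [s [sP ->]].
  exists [seq mop u1 n x | x <- s]; rewrite big_map (lin_sum (mopr _ _)).
  split => // _ /mapP [x /sP [m mP xm] ->].
  exact: minw_shift hm mP (mwt_mop n u1d xm).
Qed.

(** Again uniform in [h]: for [n] at least d + P the image would have weight below [h]. *)
Lemma gsum_trunc (v : V) (P : nat) : exists N : int, forall (n : int) h u,
  N <= n ->
  minw h -> gsum h P u -> mop v n u = 0.
Proof.
elim/vwt_ind: v.
- by exists 0 => n h u _ _ _; rewrite (lin0 (mopl _ _)).
- move=> u1 u2 [N1 H1] [N2 H2]; exists (Num.max N1 N2) => n h u.
  rewrite ge_max => /andP [n1 n2] hm uP.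
  by rewrite (linD (mopl _ _)) (H1 _ _ _ n1 hm uP) (H2 _ _ _ n2 hm uP) addr0.
- move=> d u1 u1d; exists (d + P%:Z) => n h u nP [_ h0] [s [sP ->]].
  rewrite (lin_sum (mopr _ _)) big_seq big1 // => x /sP [m mP xm].
  have := mwt_mop n u1d xm.
  have [k E] : exists k : nat, m%:Z + (d - n - 1) = - k.+1%:Z.
    by exists (`|(n + 1 - d - m%:Z)%R|.-1)%N; lia.
  by rewrite -addrA -[m%:R]/(m%:Z%:~R) -intrD E mulrNz => /h0.
Qed.

(* The degree of the components is bounded uniformly in h: this is what makes
   the modes of the product lower truncated. *)
Definition gp_set : set (R -> W) := [set f |
  (forall h, ~ minw h -> f h = 0) /\ exists P, forall h, gsum h P (f h)].

Definition gp_pred : pred (R -> W) := fun f => `[< gp_set f >].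

Lemma gp_submod_closed : submod_closed gp_pred.
Proof.
split=> [|a f g].
  by apply/asboolP; split => //; exists 0%N => h; exact: gsum0.
move=> /asboolP [f0 [P fP]] /asboolP [g0 [Q gQ]]; apply/asboolP; split.
  by move=> h hm; rewrite -[LHS]/(a *: f h + g h) f0 // g0 // scaler0 addr0.
exists (maxn P Q) => h; apply: gsumD.
  by apply: gsumZ; apply: gsum_le (fP h); rewrite leq_maxl.
by apply: gsum_le (gQ h); rewrite leq_maxr.
Qed.

HB.instance Definition _ :=
  GRing.isSubmodClosed.Build C (R -> W) gp_pred gp_submod_closed.

Record gp := Gp { gp_val :> R -> W ; gp_valP : gp_val \in gp_pred }.

HB.instance Definition _ := [isSub for gp_val].
HB.instance Definition _ := [Choice of gp by <:].
HB.instance Definition _ := [SubChoice_isSubLmodule of gp by <:].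

Lemma gp_ext (f g : gp) : (forall h, f h = g h) -> f = g.
Proof. by move=> fg; apply: val_inj; apply/funext. Qed.

Lemma gpP (f : gp) : gp_set f.
Proof. by have /asboolP := gp_valP f. Qed.

Lemma gp_out (f : gp) h : ~ minw h -> f h = 0.
Proof. by have [f0 _] := gpP f; exact: f0. Qed.

Lemma gp_linE a (f g : gp) h : (a *: f + g) h = a *: f h + g h.
Proof. by []. Qed.

Lemma gp_sumE (I : Type) (s : seq I) (F : I -> gp) h :
  (\sum_(i <- s) F i) h = \sum_(i <- s) F i h.
Proof. by rewrite (big_morph (fun f : gp => f h) (id1 := 0) (op1 := +%R)). Qed.

(** A sum over all of [nat] is 0 by convention when its support is infinite, so evaluation at [h]
    commutes with it only under a bound on the support of [F] itself. *)
Lemma gp_fsumE (F : nat -> gp) (N : nat) h :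
  (forall l, (N <= l)%N -> F l = 0) ->
  (\sum_(l \in [set: nat]) F l) h = \sum_(l \in [set: nat]) F l h.
Proof.
move=> F0; rewrite (fsum_nat F0) gp_sumE; apply/esym/fsum_nat => l /F0 ->.
by [].
Qed.

Lemma gp_mop_subproof (v : V) (n : int) (f : gp) :
  (fun h => mop v n (f h)) \in gp_pred.
Proof.
have [f0 [P fP]] := gpP f; have [Q H] := gsum_mop v n P.
apply/asboolP; split=> [h hm|]; first by rewrite f0 // (lin0 (mopr _ _)).
exists Q => h; have [hm|hm] := pselect (minw h); first exact: H.
by rewrite f0 // (lin0 (mopr _ _)); exact: gsum0.
Qed.

Definition gp_mop (v : V) (n : int) (f : gp) : gp := Gp (gp_mop_subproof v n f).

Lemma gp_trunc : lower_truncated gp_mop.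
Proof.
move=> v f; have [f0 [P fP]] := gpP f; have [N NP] := gsum_trunc v P.
exists N => n Nn; apply: gp_ext => h /=.
have [hm|hm] := pselect (minw h); first exact: NP (fP h).
by rewrite f0 // (lin0 (mopr _ _)).
Qed.

Lemma gp_jacobi : jacobi (@vop _ V) gp_mop gp_mop gp_mop.
Proof.
move=> u w b m n s; apply: gp_ext => h.
have -> (f g : gp) : (f - g) h = f h - g h by [].
(* Truncation bounds for the three sums, which allow the identity to be checked component by
   component. *)
have [N1 H1] := vop_truncated u w; have [N2 H2] := gp_trunc w b.
have [N3 H3] := gp_trunc u b.
have gp0 v k : gp_mop v k 0 = 0.
  by apply: gp_ext => j /=; rewrite (lin0 (mopr _ _)).
have gp0l k f : gp_mop 0 k f = 0.
  by apply: gp_ext => j /=; rewrite (lin0 (mopl _ _)).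
rewrite (@gp_fsumE _ `|N1 - n|); last first.
  by move=> l lN; rewrite H1 ?gp0l ?scaler0 //; lia.
rewrite (@gp_fsumE _ `|N2 - s|); last first.
  by move=> l lN; rewrite H2 ?gp0 ?scaler0 //; lia.
rewrite (@gp_fsumE _ `|N3 - m|); last first.
  by move=> l lN; rewrite H3 ?gp0 ?scaler0 //; lia.
exact: (@mop_jacobi _ V W u w (b h) m n s).
Qed.

Lemma gp_bilinear : bilinear_modes gp_mop.
Proof.
split=> [n f a u v|u n a f g]; apply: gp_ext => h.
  by rewrite gp_linE /= (mopl _ _).
by rewrite gp_linE /= (mopr _ _).
Qed.

Lemma gp_vac n (f : gp) : gp_mop (vac V) n f = if n == -1 then f else 0.
Proof. by apply: gp_ext => h /=; rewrite mop_vac; case: ifP. Qed.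

Definition gp_module : weak_module V :=
  WeakModule gp_bilinear gp_trunc gp_vac gp_jacobi.

(** Degrees are counted from the lowest weight of each coset. One degree thus mixes many
    L_0-eigenvalues, which an N-gradable weak module permits. *)
Definition gp_grade (n : nat) : set gp_module :=
  [set f | forall h, mwt (h + n%:R) ((f : gp) h)].

Lemma gp_N_gradable : N_gradable gp_module.
Proof.
exists gp_grade; split; last first.
  move=> d v vd m n f fn.
  case E : (n%:Z + d - m - 1) => [p|p] => [h|].
    have := mwt_mop m vd (fn h).
    rewrite -addrA -[n%:R]/(n%:Z%:~R) -intrD.
    by have -> : n%:Z + (d - m - 1) = p by lia.
  apply: gp_ext => h /=.
  have [hm|hm] := pselect (minw h); last by rewrite gp_out // (lin0 (mopr _ _)).
  have := mwt_mop m vd (fn h).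
  rewrite -addrA -[n%:R]/(n%:Z%:~R) -intrD.
  have -> : n%:Z + (d - m - 1) = - p.+1%:Z by lia.
  by rewrite mulrNz; exact: hm.2.
split.
- move=> n; split=> [h|a f g fn gn h]; first exact: mwt0.
  by rewrite gp_linE; apply: mwtD (gn h); apply: mwtZ (fn h).
(* The uniform bound [P] makes finitely many degrees suffice for all cosets at once; the chosen
   components are set to 0 off [minw] to stay in the product. *)
- move=> f; have [f0 [P fP]] := gpP f.
  have [F HF] := choice (fun h => gsum_comp (fP h)).
  have Fgp n : (fun h => if `[< minw h >] then F h n else 0) \in gp_pred.
    apply/asboolP; split=> [h hm|]; first by case: asboolP.
    exists n.+1 => h; case: asboolP => hm; last exact: gsum0.
    exists [:: F h n]; rewrite big_seq1; split=> // x.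
    by rewrite inE => /eqP ->; exists n => //; have [] := HF h.
  exists (iota 0 P), (fun n => Gp (Fgp n)); split.
    move=> n h /=; case: asboolP => hm; last exact: mwt0.
    by have [] := HF h.
  apply: gp_ext => h; rewrite gp_sumE /=; case: asboolP => hm.
    have [_ _ ->] := HF h.
    by rewrite -(big_mkord xpredT (F h)) /index_iota subn0.
  by rewrite big1 // gp_out.
(* Independence: pairing one summand at [h] with the vanishing sum leaves its squared norm, by
   orthogonality of distinct weights. *)
- move=> s f s_uniq fn fs i si; apply: gp_ext => h; apply/eqP.
  rewrite -[_ == _](dnorm_eq0 (um_ip W)); apply/eqP.
  have : um_ip W (f i h) ((\sum_(j <- s) f j : gp) h) = 0.
    by rewrite fs; exact: linear0r.
  rewrite gp_sumE linear_sumr (bigD1_seq i) //= big1 ?addr0 // => j ji.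
  apply: mwt_orth (fn i h) (fn j h) _.
  by rewrite (inj_eq (addrI _)) eqr_nat eq_sym.
Qed.

(** If the two differed, the larger one would have a nonzero weight space a positive integer below
    it. *)
Lemma minw_inj h h' (n n' : nat) : minw h -> minw h' ->
  h + n%:R = h' + n'%:R -> h = h'.
Proof.
wlog nn' : h h' n n' / (n <= n')%N.
  by move=> H m1 m2 E; case: (leqP n n') => [/H|/ltnW /H nn'];
    [exact|apply/esym/nn'].
move=> [_ m1] [[u uh u0] _] E.
have {}E : h = h' + (n' - n)%:R by rewrite natrB //; lra.
case: (n' - n)%N E => [|k] E; first by rewrite E addr0.
by case/eqP: u0; apply: (m1 k); rewrite E addrK.
Qed.

(* On a nonzero irreducible N, two components with nonzero restriction would be
   isomorphic modules, although L_0 has disjoint spectra on them. *)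
Lemma irreducible_component (N : set gp_module) (f f' : gp_module) (h h' : R) :
  irreducible_submodule N -> N f -> N f' ->
  (f : gp) h != 0 -> (f' : gp) h' != 0 -> h = h'.
Proof.
move=> [[[N0 Nlin] Nmop] _ Nirr] Nf Nf' fh f'h'; apply/eqP/negP => /negP hh'.
have minwN (g : gp) k : g k != 0 -> minw k.
  by move=> gk; apply: contrapT => /(gp_out g) /eqP; exact/negP.
have hm := minwN _ _ fh; have hm' := minwN _ _ f'h'.
(* Evaluation at [k] is injective on [N] unless it vanishes there, since its kernel is a submodule
   of an irreducible one. *)
have ker0 (k : R) (g : gp_module) : N g -> (g : gp) k != 0 ->
    forall y : gp_module, N y -> (y : gp) k = 0 -> y = 0.
  move=> Ng gk y Ny yk.
  pose N' := [set z : gp_module | N z /\ (z : gp) k = 0].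
  have N'sub : submodule N'.
    split; first split; first by split.
      move=> a u v [Nu uk] [Nv vk]; split; first exact: Nlin.
      by rewrite gp_linE uk vk scaler0 addr0.
    move=> v n x [Nx xk]; split; first exact: Nmop.
    by rewrite /= xk (lin0 (mopr _ _)).
  have [|N'0|N'N] := Nirr N' N'sub; first by move=> z [].
    by have N'y : N' y by []; rewrite N'0 in N'y.
  have [_ /eqP] : N' g by rewrite N'N.
  by rewrite (negbTE gk).
have y0 (s : seq W) : forall y : gp_module, N y ->
    (forall x, x \in s -> exists n : nat, mwt (h + n%:R) x) ->
    (y : gp) h = \sum_(x <- s) x -> y = 0.
  (* Induction on the number of weight vectors in the component at [h]. The vector [y1] below is
     (L_0 - (h + n)) y and has one term fewer there, so it is 0. Then the component of y at [h'] has
     weight h + n, outside the coset of [h'], hence vanishes, and so does y. *)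
  elim: (size s) {-2}s (erefl (size s)) => {s} [|k IHk] [|x s] // sz y Ny sP ys.
    by apply: ker0 Nf fh _ Ny _; rewrite ys big_nil.
  have [n xn] := sP x (mem_head _ _).
  pose y1 : gp_module := (- (h + n%:R)%:C) *: y + @mop _ _ gp_module (conf V)
    (0 + 1) y.
  have y1E k' : (y1 : gp) k' = (- (h + n%:R)%:C) *: (y : gp) k' + vir 0 ((y :
    gp) k').
    by [].
  have y10 : y1 = 0.
    apply: (IHk [seq (- (h + n%:R)%:C) *: z + vir 0 z | z <- s]).
    - by rewrite size_map; case: sz => ->.
    - by apply: Nlin => //; exact: Nmop.
    - move=> _ /mapP [z zs ->]; have [|m zm] := sP z;
      first by rewrite inE zs orbT.
      exists m; apply: mwtD; first exact: mwtZ.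
      by rewrite (mwt_L0 zm); exact: mwtZ.
    - rewrite y1E ys big_cons big_map big_split /= -scaler_sumr.
      rewrite (linD (vir_lin _)) scalerDr (lin_sum (vir_lin _)) (mwt_L0 xn).
      by rewrite addrACA scaleNr addNr add0r.
  apply: ker0 Nf' f'h' _ Ny _.
  have yw : mwt (h + n%:R) ((y : gp) h').
    apply: mwt_eigen; have /eqP := congr1 (fun g : gp => g h') y10.
    by rewrite y1E scaleNr addrC subr_eq0 => /eqP.
  have [_ [P /(_ h')]] := gpP y => /gsum_comp [F [Fw _ Fs]].
  apply/eqP; rewrite -[_ == _](dnorm_eq0 (um_ip W)) {2}Fs linear_sumr big1 //
    => i _.
  apply: mwt_orth yw (Fw i) _; apply: contra hh' => /eqP E.
  by apply/eqP; exact: minw_inj hm hm' E.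
have [_ [P /(_ h)]] := gpP f => -[s [sP fs]].
have f0 : f = 0 by apply: (y0 s f Nf _ fs) => x /sP [n _ xn]; exists n.
by case/eqP: fh; rewrite f0.
Qed.

Lemma minw_finite :
  (forall M : weak_module V, N_gradable M -> completely_reducible M) ->
  finite_set minw.
Proof.
move=> /(_ gp_module gp_N_gradable) [I [N [Nirr Ndir]]].
(* A choice of a nonzero lowest weight vector in each coset; its nonvanishing at every [h] in [minw]
   is what forces finiteness. *)
pose x0 (h : R) : W := xget 0 [set u : W | mwt h u /\ u != 0].
have x0P h : minw h -> mwt h (x0 h) /\ x0 h != 0.
  move=> [[u uh u0] _]; exact: (@xgetPex _ 0 [set u : W | mwt h u /\ u != 0]
    (ex_intro _ u (conj uh u0))).
have x_gp : (fun h => if `[< minw h >] then x0 h else 0) \in gp_pred.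
  apply/asboolP; split=> [h hm|]; first by case: asboolP.
  exists 1%N => h; case: asboolP => hm; last exact: gsum0.
  exists [:: x0 h]; rewrite big_seq1; split=> // x.
  by rewrite inE => /eqP ->; exists 0%N => //; rewrite addr0; case: (x0P h hm).
have [s [f [_ Nf xs]]] := dsum_uniq Ndir (Gp x_gp).
apply: (@sub_finite_set _ _ (\bigcup_(i in [set` s]) [set h | f i h != 0])).
  move=> h hm; apply: contrapT => nh; have [_ /eqP] := x0P h hm; apply.
  have := congr1 (fun g : gp => g h) xs; rewrite /= asboolT // => ->.
  rewrite gp_sumE big_seq big1 // => i si; apply/eqP/negPn/negP => fi.
  by apply: nh; exists i.
apply: bigcup_finite; first exact: finite_seq.
move=> i _; have [[h hi]|ni] := pselect (exists h, f i h != 0).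
  apply: (@sub_finite_set _ _ [set h]); last exact: finite_set1.
  move=> h' h'i; exact: irreducible_component (Nirr i) (Nf i) (Nf i) h'i hi.
apply: (@sub_finite_set _ _ set0); last exact: finite_set0.
by move=> h hi; apply: ni; exists h.
Qed.

(** Descend by positive integers while a nonzero weight space remains below; [mwt_below] bounds the
    number of descents. *)
Lemma mwt_minw (s : R) (u : W) : mwt s u -> u != 0 ->
  exists2 h, minw h & exists n : nat, s = h + n%:R.
Proof.
have [N N0] := mwt_below W.
move=> us u0; have [k sk] : exists k : nat, s < N + k%:R.
  exists (Num.truncn (s - N)).+1; rewrite -ltrBlDl; exact: truncnS_gt.
elim: k s u us u0 sk => [s u us u0|k IHk s u us u0 sk].
  by rewrite addr0 => /(N0 _ _ us)/eqP; rewrite (negbTE u0).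
have [[j [v vs v0]]|nv] :=
    pselect (exists j : nat, exists2 v : W, mwt (s - j.+1%:R) v & v != 0).
  have [|h hm [n E]] := IHk _ _ vs v0.
    by move: sk; rewrite -!natr1; have := ler0n R j; lra.
  exists h => //; exists (n + j.+1)%N; rewrite natrD addrA -E; lra.
exists s; last by exists 0%N; rewrite addr0.
split; first by exists u.
move=> j v vs; apply/eqP/negPn/negP => v0; apply: nv; by exists j, v.
Qed.

End GradedProduct.

(** * Norms and closed graphs *)

Section ComplexNorms.
Variable R : rcfType.
Local Notation C := R[i].

(** Norms take values in the partially ordered field [C]; the real part moves estimates to [R],
    where the order is total. *)
Definition nr (Z : normedZmodType C) (x : Z) : R := complex.Re `|x|.

Lemma realcD (a b : R) : (a + b)%:C = a%:C + b%:C.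
Proof. exact: (rmorphD (real_complex R)). Qed.

Lemma realcM (a b : R) : (a * b)%:C = a%:C * b%:C.
Proof. exact: (rmorphM (real_complex R)). Qed.

Section Norms.
Variable Z : normedZmodType C.
Implicit Types x y : Z.

Lemma nrE x : `|x| = (nr x)%:C.
Proof. by rewrite /nr RRe_real // normr_real. Qed.

Lemma nr_ge0 x : 0 <= nr x.
Proof. by rewrite -lecR -nrE normr_ge0. Qed.

Lemma nrD x y : nr (x + y) <= nr x + nr y.
Proof. by rewrite -lecR realcD -!nrE ler_normD. Qed.

Lemma nrN x : nr (- x) = nr x.
Proof. by rewrite /nr normrN. Qed.

Lemma nrBC x y : nr (x - y) = nr (y - x).
Proof. by rewrite -nrN opprB. Qed.

Lemma nr0 : nr (0 : Z) = 0.
Proof. by rewrite /nr normr0. Qed.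

Lemma nr_eq0 x : nr x = 0 -> x = 0.
Proof. by move=> x0; apply/eqP; rewrite -normr_eq0 nrE x0. Qed.

Lemma nr_sum (I : Type) (s : seq I) (F : I -> Z) :
  nr (\sum_(i <- s) F i) <= \sum_(i <- s) nr (F i).
Proof.
elim/big_ind2: _ => [|x1 x2 y1 y2 h1 h2|//]; first by rewrite nr0.
exact: le_trans (nrD _ _) (lerD h1 h2).
Qed.

End Norms.

Lemma nrM (a b : C) : nr (a * b) = nr a * nr b.
Proof.
by apply: complexI; rewrite realcM -!nrE normrM.
Qed.

Lemma nr_real (a : R) : nr (a%:C : C) = `|a|.
Proof. by rewrite /nr normc_def /= expr0n addr0 sqrtr_sqr. Qed.

End ComplexNorms.

Lemma nrZ (R : realType) (H : normedModType R[i]) (a : R[i]) (x : H) :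
  nr (a *: x) = nr a * nr x.
Proof.
by apply: complexI; rewrite realcM -!nrE normrZ.
Qed.

Section DotProducts.
Variables (R : realType) (U : lmodType R[i]) (f : {dot U for Num.conj}).

Lemma dotC u v : f u v = Num.conj (f v u).
Proof. by rewrite (hermC f) expr0 mul1r. Qed.

Lemma dotDl u v w : f (u + v) w = f u w + f v w. Proof. exact: linearDl. Qed.
Lemma dotBl u v w : f (u - v) w = f u w - f v w. Proof. exact: linearBl. Qed.
Lemma dotDr u v w : f u (v + w) = f u v + f u w. Proof. exact: linearDr. Qed.
Lemma dotBr u v w : f u (v - w) = f u v - f u w. Proof. exact: linearBr. Qed.
Lemma dotZl a u v : f (a *: u) v = a * f u v. Proof. exact: linearZl_LR. Qed.
Lemma dotZr a u v : f u (a *: v) = Num.conj a * f u v.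
Proof. exact: linearZr_LR. Qed.
Lemma dot0l v : f 0 v = 0. Proof. exact: linear0l. Qed.
Lemma dot0r v : f v 0 = 0. Proof. exact: linear0r. Qed.
Lemma dot_suml (I : Type) (s : seq I) (F : I -> U) v :
  f (\sum_(i <- s) F i) v = \sum_(i <- s) f (F i) v.
Proof. exact: linear_sumlz. Qed.
Lemma dot_sumr (I : Type) (s : seq I) (F : I -> U) v :
  f v (\sum_(i <- s) F i) = \sum_(i <- s) f v (F i).
Proof. exact: linear_sumr. Qed.

(** Split u into a multiple of v and a part [u1] orthogonal to v, and use Pythagoras. *)
Lemma dot_CauchySchwarz u v : `|f u v| ^+ 2 <= f u u * f v v.
Proof.
have [->|v0] := eqVneq v 0; first by rewrite !dot0r normr0 expr0n mulr0.
have fv : f v v != 0 by rewrite (dnorm_eq0 f).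
pose a := f u v / f v v; pose u1 := u - a *: v.
have o1 : f u1 v = 0 by rewrite dotBl dotZl divfK // subrr.
have -> : f u v = a * f v v by rewrite divfK.
have uE : u = u1 + a *: v by rewrite subrK.
have -> : f u u = f u1 u1 + `|a| ^+ 2 * f v v.
  clearbody u1; rewrite {1 2}uE.
  rewrite dotDl !dotDr !dotZl !dotZr o1 (dotC v u1) o1 rmorph0 !mulr0 addr0
    add0r.
  by rewrite mulrA normCK.
rewrite normrM exprMn (ger0_norm (dnorm_ge0 f v)) mulrDl expr2 mulrA lerDr.
by rewrite mulr_ge0 // dnorm_ge0.
Qed.

End DotProducts.

(** * Weight components of vectors of the completion *)

Section GraphClosure.
Context (R : realType).
Local Notation C := R[i].

Lemma posC (e : C) : 0 < e -> exists2 d : R, 0 < d & e = d%:C.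
Proof.
move=> e0; exists (complex.Re e); last by rewrite RRe_real // gtr0_real.
by rewrite -ltcR RRe_real // gtr0_real.
Qed.

Lemma ball_nr (H : normedModType C) (x y : H) (d : R) :
  ball x d%:C y <-> nr (x - y) < d.
Proof. by rewrite -ball_normE /= -ltcR -nrE. Qed.

Lemma closure_graph (H K : normedModType C) (A : set (H * K)) (p : H * K) :
  closure A p <-> forall e : R, 0 < e ->
    exists2 q, A q & nr (p.1 - q.1) < e /\ nr (p.2 - q.2) < e.
Proof.
split=> [Ap e e0|Ap B /nbhs_ballP [e /= /posC [d d0 ->]] pB].
  have eC : 0 < e%:C :> C by rewrite -[0]/(0%:C) ltcR.
  have [q [Aq [q1 q2]]] := Ap _ (nbhsx_ballx p _ eC).
  by exists q => //; split; apply/ball_nr.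
have [q Aq [q1 q2]] := Ap d d0; exists q; split => //.
by apply: pB; split; apply/ball_nr.
Qed.

Lemma nr_small (Z : normedZmodType C) (x : Z) (k : R) :
  0 <= k -> (forall e : R, 0 < e -> nr x <= k * e) -> x = 0.
Proof.
move=> k0 xe; apply: nr_eq0; apply/eqP; rewrite eq_le nr_ge0 andbT.
apply/ler_addgt0Pr => e e0; rewrite add0r.
have k1 : 0 < k + 1 by lra.
apply: le_trans (xe (e / (k + 1)) _) _; first by rewrite divr_gt0.
by rewrite mulrCA ger_pMr // ler_pdivrMr // mul1r; lra.
Qed.

(** The rate k / (N + 1) is the one supplied by tails of the series of inverse squares. *)
Lemma cauchy_seq (H : completeNormedModType C) (S : nat -> H) (k : R) :
  (forall N M, (N <= M)%N -> nr (S M - S N) <= k / N.+1%:R) ->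
  exists y, forall e : R, 0 < e ->
    exists N, forall n, (N <= n)%N -> nr (y - S n) < e.
Proof.
move=> Sk.
have k0 : 0 <= k by apply: le_trans (nr_ge0 _) _; rewrite -(divr1 k);
  exact: (Sk 0%N 0%N).
have small (e : R) : 0 < e -> exists N : nat, k / N.+1%:R < e.
  move=> e0; exists (Num.truncn (k / e)).
  rewrite ltr_pdivrMr // mulrC -ltr_pdivrMr //; exact: truncnS_gt.
have : cauchy (S @ \oo).
  apply: cauchy_exP => e /posC [d d0 ->].
  have [N Nd] := small _ d0; exists (S N); exists N => // n /= Nn.
  by apply/ball_nr; rewrite nrBC (le_lt_trans (Sk _ _ Nn)).
move=> /(@cauchy_cvgP H) /cvg_ex [y Sy]; exists y => e e0.
have eC : 0 < e%:C :> C by rewrite -[0]/(0%:C) ltcR.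
have [N _ NP] := Sy _ (nbhsx_ballx y _ eC).
by exists N => n Nn; apply/ball_nr; exact: NP.
Qed.

End GraphClosure.

Section Completion.
Context (R : realType) (V : unitary_voa R) (W : unitary_module V).
Context (H : completion W).
Local Notation C := R[i].
Local Notation E := (hc_in H).

Lemma hc_in_sum (I : Type) (s : seq I) (F : I -> W) :
  E (\sum_(i <- s) F i) = \sum_(i <- s) E (F i).
Proof. exact: linear_sum. Qed.

Lemma hc_nr (x : H) : hc_ip H x x = ((nr x) ^+ 2)%:C.
Proof. by rewrite -hc_norm nrE !expr2 realcM. Qed.

Lemma hc_CS (x y : H) : nr (hc_ip H x y) <= nr x * nr y.
Proof.
rewrite -(@ler_pXn2r _ 2) ?nnegrE ?mulr_ge0 ?nr_ge0 //.
have := dot_CauchySchwarz (hc_ip H) x y.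
by rewrite !hc_nr nrE exprMn -realcM !expr2 -!realcM lecR.
Qed.

Lemma hc_dense_nr (x : H) (e : R) : 0 < e -> exists w, nr (x - E w) < e.
Proof.
move=> e0; have eC : 0 < e%:C :> C by rewrite -[0]/(0%:C) ltcR.
have [|] := @hc_dense _ _ _ H (ball x e%:C)° _ (open_interior _).
  by exists x; exact: nbhsx_ballx.
by move=> z [/interior_subset xz [w _ wE]]; exists w; rewrite wE; exact/ball_nr.
Qed.

Lemma hc_ext0 (z : H) : (forall v, hc_ip H z (E v) = 0) -> z = 0.
Proof.
move=> zE; apply: (nr_small ler01) => e e0; rewrite mul1r.
have [z0|z0] := eqVneq (nr z) 0; first by rewrite z0 ltW.
have z_gt0 : 0 < nr z by rewrite lt_neqAle eq_sym z0 nr_ge0.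
have [w zw] := hc_dense_nr z e0.
have zz : hc_ip H z z = hc_ip H z (z - E w) by rewrite dotBr zE subr0.
have : nr (hc_ip H z z) <= nr z * e.
  by rewrite zz; apply: le_trans (hc_CS _ _) _; rewrite ler_pM2l // ltW.
by rewrite hc_nr nr_real ger0_norm ?sqr_ge0 // expr2 ler_pM2l.
Qed.

(** Weight vectors span a dense subspace. Every uniqueness statement about vectors of the completion
    rests on this test. *)
Lemma hc_ext (x y : H) :
  (forall s (v : W), mwt s v -> hc_ip H x (E v) = hc_ip H y (E v)) -> x = y.
Proof.
move=> xy; apply/eqP; rewrite -subr_eq0; apply/eqP/hc_ext0.
elim/mwt_ind => [|u v hu hv|s u us]; first by rewrite linear0 dot0r.
  by rewrite linearD dotDr hu hv addr0.
by rewrite dotBl (xy _ _ us) subrr.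
Qed.

Definition nrW (v : W) : R := nr (E v).

Lemma nrWE (v : W) : um_ip W v v = ((nrW v) ^+ 2)%:C.
Proof. by rewrite -(hc_isometry H) hc_nr. Qed.

Lemma um_CS (u v : W) : nr (um_ip W u v) <= nrW u * nrW v.
Proof. by rewrite -(hc_isometry H); exact: hc_CS. Qed.

(* Riesz representation on a finite-dimensional subspace, with the
   representing vector cut down to the weight space by orthogonality. *)
Lemma span_riesz (bs : seq W) (phi : W -> C) :
  (forall a u v, phi (a *: u + v) = a * phi u + phi v) ->
  exists2 a, (forall S : set W, Defs.subspace S -> {subset bs <= S} -> S a) &
    forall b, b \in bs -> phi b = um_ip W b a.
Proof.
elim: bs phi => [|b bs IHbs] phi phi_lin.
  by exists 0 => // S [S0 _].
have [a a_span aP] := IHbs _ phi_lin.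
have [|p p_span pP] := IHbs (fun v => um_ip W v b).
  by move=> c u v; rewrite dotDl dotZl.
have sub_lin (psi : W -> C) c : (forall a u v,
  psi (a *: u + v) = a * psi u + psi v) ->
    (forall x, x \in bs -> psi x = um_ip W x c) -> psi p = um_ip W p c.
  move=> psi_lin psi_bs; apply: (p_span [set v | psi v = um_ip W v c]).
    split=> /=; last by move=> k u v pu pv; rewrite psi_lin pu pv dotDl dotZl.
    have := psi_lin (-1) 0 0; rewrite scaler0 addr0 mulN1r addNr dot0l => ->.
    by [].
  by move=> x /psi_bs xb; apply/mem_set.
(* A Gram-Schmidt step: [p] is the orthogonal projection of [b] to the span of [bs], and the
   representing vector is corrected along [c], unless [c] is 0. *)
pose c := b - p.
have c_bs x : x \in bs -> um_ip W x c = 0.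
  by move=> xb; rewrite dotBr (pP x xb) subrr.
have cp : um_ip W p c = 0.
  rewrite dotBr (sub_lin (fun v => um_ip W v b) p) ?subrr //.
  by move=> k u v; rewrite dotDl dotZl.
have bc : um_ip W b c = um_ip W c c by rewrite {2}/c dotBl cp subr0.
have [c0|c0] := eqVneq c 0.
  exists a => [S Ssub bsS|x].
    by apply: a_span => // x xb; apply: bsS; rewrite inE xb orbT.
  rewrite inE => /orP [/eqP ->|]; last exact: aP.
  by have -> : b = p by [apply/eqP; rewrite -subr_eq0 -/c c0|];
    exact: sub_lin aP.
have cc : um_ip W c c != 0 by rewrite (dnorm_eq0 (um_ip W)).
pose k := (phi b - um_ip W b a) / um_ip W c c.
exists (Num.conj k *: c + a) => [S Ssub bsS|x].
  have S_bs (u : W) : (forall S : set W, Defs.subspace S ->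
    {subset bs <= S} -> S u) -> S u.
    by apply => // x xb; apply: bsS; rewrite inE xb orbT.
  apply: Ssub.2; last exact: S_bs.
  rewrite /c addrC -scaleN1r; apply: Ssub.2; first exact: S_bs.
  by apply/set_mem/bsS/mem_head.
rewrite dotDr dotZr conjCK inE => /orP [/eqP ->|xb].
  by rewrite bc divfK // subrK.
by rewrite c_bs // mulr0 add0r aP.
Qed.

Lemma mwt_riesz (s : R) (phi : W -> C) :
  (forall a u v, phi (a *: u + v) = a * phi u + phi v) ->
  exists2 a : W, mwt s a & forall v, mwt s v -> phi v = um_ip W v a.
Proof.
move=> phi_lin; have [n [b bP]] := mwt_finite W s.
have [a _ aP] := span_riesz [seq b i | i <- enum 'I_n] phi_lin.
have phi0 : phi 0 = 0.
  by have := phi_lin (-1) 0 0; rewrite scaler0 addr0 mulN1r addNr.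
have phiD u v : phi (u + v) = phi u + phi v.
  by have := phi_lin 1 u v; rewrite scale1r mul1r.
have phiZ k u : phi (k *: u) = k * phi u.
  by have := phi_lin k u 0; rewrite !addr0 phi0 addr0.
have aW v : mwt s v -> phi v = um_ip W v a.
  move=> /bP [m [c [d [dP ->]]]].
  rewrite dot_suml (big_morph phi phiD phi0); apply: eq_bigr => i _.
  rewrite phiZ dotZl; have [j _ <-] := dP i; congr (_ * _); apply: aP.
  by apply/mapP; exists j; rewrite ?mem_enum.
have [l [f [l_uniq fw aE]]] := dsum_uniq (mwt_direct W) a.
exists (if s \in l then f s else 0); first by case: ifP => _ //; exact: mwt0.
move=> v vs; rewrite aW // aE dot_sumr.
have fs0 i : i != s -> um_ip W v (f i) = 0.
  by rewrite eq_sym; exact: mwt_orth vs (fw i).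
case: ifPn => sl; first by rewrite (bigD1_seq s) //= big1 ?addr0.
rewrite dot0r big_seq big1 // => i il; apply: fs0.
by apply: contra sl => /eqP <-.
Qed.
(** The weak form of z = f(L_0) x, component by component. [L0cl_wk] and [op_fun_wk] show that it
    describes exactly the closed graphs, so closures need not be handled afterwards. *)
Definition wk_rel (f : R -> C) (x z : H) : Prop :=
  forall s (v : W), mwt s v -> hc_ip H z (E v) = f s * hc_ip H x (E v).

Lemma wk_rel_inj f x z z' : wk_rel f x z -> wk_rel f x z' -> z = z'.
Proof. by move=> xz xz'; apply: hc_ext => s v vs;
  rewrite (xz s) // (xz' s). Qed.

Lemma closure_wk_rel f (A : set (H * H)) (p : H * H) :
  (forall q, A q -> wk_rel f q.1 q.2) -> closure A p -> wk_rel f p.1 p.2.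
Proof.
move=> Af /closure_graph pA s v vs; apply/eqP; rewrite -subr_eq0; apply/eqP.
apply: (@nr_small R _ _ (nrW v * (1 + nr (f s)))).
  by rewrite mulr_ge0 ?addr_ge0 ?nr_ge0.
move=> e e0; have [q /Af /(_ s v vs) qE [q1 q2]] := pA e e0.
have -> : hc_ip H p.2 (E v) - f s * hc_ip H p.1 (E v) =
    hc_ip H (p.2 - q.2) (E v) - f s * hc_ip H (p.1 - q.1) (E v).
  by rewrite !dotBl qE mulrBr opprB addrA subrK.
apply: le_trans (nrD _ _) _; rewrite nrN nrM mulrDr mulr1 mulrDl.
have CS (y : H) : nr y < e -> nr (hc_ip H y (E v)) <= nrW v * e.
  move=> ye; apply: le_trans (hc_CS _ _) _.
  by rewrite mulrC ler_wpM2l ?nr_ge0 // ltW.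
apply: lerD; first exact: CS.
by rewrite -mulrA [X in _ <= X]mulrCA ler_wpM2l ?nr_ge0 // CS.
Qed.

Lemma wk_relD f x y z t : wk_rel f x z -> wk_rel f y t ->
  wk_rel f (x + y) (z + t).
Proof. by move=> xz yt s v vs; rewrite !dotDl (xz s) // (yt s) // mulrDr. Qed.

Lemma wk_relZ f a x z : wk_rel f x z -> wk_rel f (a *: x) (a *: z).
Proof. by move=> xz s v vs; rewrite !dotZl (xz s) // mulrCA. Qed.

Lemma wk_rel0 f : wk_rel f 0 0.
Proof. by move=> s v vs; rewrite dot0l mulr0. Qed.

Lemma wk_rel_sum f (l : seq R) (P : R -> W) : (forall s, mwt s (P s)) ->
  wk_rel f (E (\sum_(s <- l) P s)) (E (\sum_(s <- l) f s *: P s)).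
Proof.
move=> Pw; elim: l => [|s l IHl]; first by rewrite !big_nil linear0;
  exact: wk_rel0.
rewrite !big_cons !linearD; apply: wk_relD IHl => r v vr.
rewrite linearZ dotZl !hc_isometry.
have [->//|sr] := eqVneq s r.
by rewrite (mwt_orth (Pw s) vr sr) !mulr0.
Qed.

(** The spectral components of x; they lie in [W] because the weight spaces are
    finite-dimensional. *)
Lemma hc_proj (x : H) : exists P : R -> W, forall s, mwt s (P s) /\
  forall v, mwt s v -> hc_ip H x (E v) = um_ip W (P s) v.
Proof.
have cP s : exists a, mwt s a /\
    forall v, mwt s v -> hc_ip H x (E v) = um_ip W a v.
  have [|a aw aP] := @mwt_riesz s (fun v => hc_ip H (E v) x).
    by move=> a u v; rewrite linearD linearZ dotDl dotZl.
  by exists a; split => // v vs; rewrite (dotC (um_ip W) a) -(aP v vs) -dotC.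
by have [P PP] := choice cP; exists P.
Qed.

(** The sum of the components over [l] is the orthogonal projection to the corresponding weight
    spaces, so it is at least as close to x as any vector supported on those weights. *)
Lemma proj_best (x : H) (P : R -> W) (l : seq R) (w : W) (l' : seq R) (g : R
  -> W) :
  (forall s, mwt s (P s) /\ forall v, mwt s v ->
    hc_ip H x (E v) = um_ip W (P s) v) ->
  uniq l -> {subset l' <= l} -> (forall s, mwt s (g s)) ->
    w = \sum_(s <- l') g s ->
  nr (x - E (\sum_(s <- l) P s)) <= nr (x - E w).
Proof.
move=> xP l_uniq l'l gw ->; set v := \sum_(s <- l) P s;
  set w' := \sum_(s <- l') _.
have ov s u : s \in l -> mwt s u -> hc_ip H (x - E v) (E u) = 0.
  move=> sl us; rewrite dotBl (xP s).2 // hc_isometry dot_suml (bigD1_seq s)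
    //=.
  rewrite big1 ?addr0 ?subrr // => i il; exact: mwt_orth (xP i).1 us il.
have o : hc_ip H (x - E v) (E (v - w')) = 0.
  have sum0 (r : seq R) (F : R -> W) : {subset r <= l} ->
    (forall s, mwt s (F s)) ->
      hc_ip H (x - E v) (E (\sum_(s <- r) F s)) = 0.
    move=> rl Fw; rewrite (hc_in_sum r F) dot_sumr big_seq big1 // => s sr.
    exact: ov (rl s sr) (Fw s).
  by rewrite (linearB E) dotBr !sum0 ?subr0 // => s; have [] := xP s.
have -> : x - E w' = (x - E v) + E (v - w') by rewrite (linearB E) addrA subrK.
rewrite -(@ler_pXn2r _ 2) ?nnegrE ?nr_ge0 // -lecR -!hc_nr.
move: (x - E v) (E (v - w')) o => y u o.
by rewrite dotDl !dotDr o (dotC (hc_ip H) u y) o rmorph0 addr0 add0r lerDl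
  hc_nr -[0]/(0%:C) lecR sqr_ge0.
Qed.

(** Truncating x and z to one common list of weights, which contains those of an approximant of
    each, approximates both at once. This makes the weight vectors a core for f(L_0). *)
Lemma wk_approx f (x z : H) (e : R) : wk_rel f x z -> 0 < e ->
  exists (l : seq R) (P : R -> W), [/\ forall s, mwt s (P s),
    nr (x - E (\sum_(s <- l) P s)) < e &
    nr (z - E (\sum_(s <- l) f s *: P s)) < e].
Proof.
move=> xz e0; have [P xP] := hc_proj x.
have [w1 w1e] := hc_dense_nr x e0; have [w2 w2e] := hc_dense_nr z e0.
have [l1 [g1 [_ g1w w1E]]] := dsum_uniq (mwt_direct W) w1.
have [l2 [g2 [_ g2w w2E]]] := dsum_uniq (mwt_direct W) w2.
exists (undup (l1 ++ l2)), P; split.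
- by move=> s; have [] := xP s.
- apply: le_lt_trans w1e.
  apply: (proj_best xP (undup_uniq _) _ g1w w1E) => s sl.
  by rewrite mem_undup mem_cat sl.
- apply: le_lt_trans w2e.
  apply: (@proj_best z (fun s => f s *: P s) _ w2 l2 g2) => //.
  + move=> s; have [Pw PE] := xP s; split; first exact: mwtZ.
    by move=> v vs; rewrite (xz s) // PE // dotZl.
  + exact: undup_uniq.
  + by move=> s sl; rewrite mem_undup mem_cat sl orbT.
Qed.

(** The hypothesis says that [b] is the adjoint of f(L_0) applied to [a], tested on weight vectors;
    the simultaneous approximation extends it to x. *)
Lemma wk_adjoint f (x z a b : H) : wk_rel f x z ->
  (forall s (v : W), mwt s v -> f s * hc_ip H (E v) a = hc_ip H (E v) b) ->
  hc_ip H z a = hc_ip H x b.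
Proof.
move=> xz ab; apply/eqP; rewrite -subr_eq0; apply/eqP.
apply: (@nr_small R _ _ (nr a + nr b)); first by rewrite addr_ge0 ?nr_ge0.
move=> e e0; have [l [P [Pw xe ze]]] := wk_approx xz e0.
set v := \sum_(s <- l) P s in xe; set v' := \sum_(s <- l) _ in ze.
have vE : hc_ip H (E v') a = hc_ip H (E v) b.
  rewrite !linear_sum !dot_suml; apply: eq_bigr => s _.
  by rewrite linearZ dotZl (ab s).
have -> : hc_ip H z a - hc_ip H x b =
    hc_ip H (z - E v') a - hc_ip H (x - E v) b.
  by rewrite !dotBl vE opprB addrA subrK.
apply: le_trans (nrD _ _) _; rewrite nrN mulrDl.
by apply: lerD; apply: le_trans (hc_CS _ _) _;
  rewrite mulrC ler_wpM2l ?nr_ge0 // ltW.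
Qed.

Lemma L0cl_wk (p : H * H) : L0cl H p <-> wk_rel (fun s => s%:C) p.1 p.2.
Proof.
split=> [|pE].
  apply: closure_wk_rel => q [w ->] /=.
  have [l [f [_ fw ->]]] := dsum_uniq (mwt_direct W) w.
  rewrite (lin_sum (vir_lin _)).
  have -> : \sum_(i <- l) vir 0 (f i) = \sum_(i <- l) i%:C *: f i.
    by apply: eq_bigr => i _; rewrite (mwt_L0 (fw i)).
  exact: wk_rel_sum.
apply/closure_graph => e e0; have [l [P [Pw xe ze]]] := wk_approx pE e0.
exists (E (\sum_(s <- l) P s), E (\sum_(s <- l) s%:C *: P s)) => //.
exists (\sum_(s <- l) P s); congr (_, E _).
rewrite (lin_sum (vir_lin _)).
by apply: eq_bigr => i _; rewrite (mwt_L0 (Pw i)).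
Qed.

Lemma op_fun_wk (f : R -> C) (p : H * H) :
  op_fun (L0cl H) f p <-> wk_rel f p.1 p.2.
Proof.
split=> [|pE].
  apply: closure_wk_rel => q [n [c [a [aP ->]]]].
  elim/big_ind: _ => [|u v hu hv|i _]; first exact: wk_rel0.
    exact: wk_relD.
  (* An eigenvector of the closure for the eigenvalue [r] has no component of weight other than
     [r]. *)
  apply: wk_relZ; have [r [/L0cl_wk /= ar ->]] := aP i.
  move=> s v vs; rewrite dotZl; have := ar s v vs; rewrite dotZl.
  have [->//|rs] := eqVneq r s => /eqP.
  rewrite -subr_eq0 -mulrBl mulf_eq0 subr_eq0 (inj_eq (@complexI _)) (negbTE
    rs).
  by move=> /eqP ->; rewrite !mulr0.
apply/closure_graph => e e0; have [l [P [Pw xe ze]]] := wk_approx pE e0.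
exists (E (\sum_(s <- l) P s), E (\sum_(s <- l) f s *: P s)) => //.
exists (size l), (fun=> 1), (fun i => (E (P (tnth (in_tuple l) i)),
  f (tnth (in_tuple l) i) *: E (P (tnth (in_tuple l) i)))); split.
  move=> i; exists (tnth (in_tuple l) i); split => //=.
  apply/L0cl_wk => s v vs /=; rewrite dotZl hc_isometry.
  have [->//|ne] := eqVneq (tnth (in_tuple l) i) s.
  by rewrite (mwt_orth (Pw _) vs ne) !mulr0.
rewrite !linear_sum.
under [RHS]eq_bigr do rewrite scale1r.
rewrite -(big_tnth _ _ l xpredT (fun s => (E (P s), f s *: E (P s)))).
elim: (l) => [|s r IHr]; first by rewrite !big_nil.
by rewrite !big_cons -IHr linearZ.
Qed.

Lemma L0pow_wk (r : R) (p : H * H) :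
  L0pow H r p <-> wk_rel (fun s => ((1 + s) `^ r)%:C) p.1 p.2.
Proof. exact: op_fun_wk. Qed.

Lemma sobolev_norm_mwt (r s : R) (v : W) : mwt s v -> v != 0 ->
  sobolev_norm H r (E v) = ((1 + s) `^ r * nrW v)%:C.
Proof.
move=> vs v0; have s0 := mwt_ge0 vs v0.
have vE : wk_rel (fun s => ((1 + s) `^ r)%:C) (E v) (((1 + s) `^ r)%:C *: E v).
  move=> s' u us; rewrite dotZl hc_isometry.
  have [->//|ss'] := eqVneq s s'.
  by rewrite (mwt_orth vs us ss') !mulr0.
rewrite /sobolev_norm /op_val.
have -> : xget 0 [set y | L0pow H r (E v, y)] = ((1 + s) `^ r)%:C *: E v.
  case: xgetP => [y _ /L0pow_wk /= yP|/(_ (((1 + s) `^ r)%:C *: E v)) []].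
    exact: wk_rel_inj yP vE.
  exact/L0pow_wk.
by rewrite nrE nrZ nr_real ger0_norm // powR_ge0.
Qed.

Lemma proj_nr (x : H) (s : R) (v : W) : mwt s v ->
  (forall u, mwt s u -> hc_ip H x (E u) = um_ip W v u) -> nrW v <= nr x.
Proof.
move=> vs vP; have [v0|v0] := eqVneq (nrW v) 0; first by rewrite v0 nr_ge0.
have v_gt0 : 0 < nrW v by rewrite lt_neqAle eq_sym v0 nr_ge0.
have := hc_CS x (E v); rewrite vP // nrWE nr_real ger0_norm ?sqr_ge0 //.
by rewrite expr2 ler_pM2r.
Qed.

Lemma wk_rel_eq f g x z : (forall s, 0 <= s -> f s = g s) ->
  wk_rel f x z -> wk_rel g x z.
Proof.
move=> fg xz s v vs; have [->|v0] := eqVneq v 0;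
  first by rewrite linear0 !dot0r mulr0.
by rewrite -fg ?(mwt_ge0 vs v0) // (xz s).
Qed.

Hypothesis minw_fin : finite_set (minw W).

(** Telescoping, from 1/(m+1)^2 <= 2/((m+1)(m+2)). *)
Lemma sum_inv_sqr (N M : nat) : (N <= M)%N ->
  \sum_(N <= n < M) (1 + n%:R) ^- 2 <= 2 / N.+1%:R - 2 / M.+1%:R :> R.
Proof.
elim: M => [|M IHM]; first by rewrite leqn0 => /eqP ->;
  rewrite big_geq // subrr.
rewrite leq_eqVlt => /orP [/eqP ->|]; first by rewrite big_geq // subrr.
rewrite ltnS => NM; rewrite big_nat_recr //=.
have {IHM} := IHM NM; set s := \sum_(_ <= _ < _) _; set t := 2 / N.+1%:R.
suff : (1 + M%:R) ^- 2 <= 2 / M.+1%:R - 2 / M.+2%:R :> R.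
  by move=> h1 h2; apply: le_trans (lerD h2 h1) _; rewrite addrA subrK.
have M0 : 0 <= M%:R :> R by rewrite ler0n.
rewrite -(natr1 M.+1) -(natr1 M).
set m : R := M%:R in M0 *.
rewrite -mulrBr -subr_ge0.
have -> : 2 * ((m + 1)^-1 - (m + 1 + 1)^-1) - (1 + m) ^- 2 =
   m / ((m + 1 + 1) * (m + 1) ^+ 2).
  by field; rewrite !lt0r_neq0 //; lra.
by rewrite divr_ge0 // mulr_ge0 ?sqr_ge0 //; lra.
Qed.

(** Components that decay like (1 + s)^-2 are summable along each coset of Z, and there are finitely
    many cosets; hence the constant, twice their number. *)
Lemma family_vec : exists2 c : R, 0 <= c & forall (b : R -> W) (k : R),
  (forall s, mwt s (b s)) ->
  (forall s, 0 <= s -> nrW (b s) * (1 + s) ^+ 2 <= k) ->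
  exists2 y : H, nr y <= c * k &
    forall s v, mwt s v -> hc_ip H y (E v) = um_ip W (b s) v.
Proof.
have /finite_seqP [ms0 ms0E] := minw_fin.
have [ms ms_uniq msE] : exists2 ms, uniq ms & forall h, minw W h <-> h \in ms.
  exists (undup ms0); first exact: undup_uniq.
  by move=> h; rewrite ms0E mem_undup.
have ms_ge0 h : h \in ms -> 0 <= h.
  by move=> /msE [[u uh u0] _]; exact: mwt_ge0 uh u0.
exists ((size ms)%:R * 2); first by rewrite mulr_ge0 ?ler0n.
move=> b k bw bk.
have k0 : 0 <= k by apply: le_trans (bk 0 (lexx _));
  rewrite mulr_ge0 ?nr_ge0 ?sqr_ge0.
pose S N := \sum_(h <- ms) \sum_(0 <= n < N) E (b (h + n%:R)).
have Sb N M : (N <= M)%N -> nr (S M - S N) <= (size ms)%:R * 2 * k / N.+1%:R.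
  move=> NM; have -> : S M - S N = \sum_(h <- ms) \sum_(N <= n < M) E (b (h +
    n%:R)).
    rewrite /S -sumrB; apply: eq_bigr => h _.
    by rewrite (big_cat_nat _ NM) //= addrAC subrr add0r.
  apply: le_trans (nr_sum _ _) _.
  apply: (@le_trans _ _ (\sum_(h <- ms) 2 * k / N.+1%:R)); last first.
    by rewrite big_const_seq count_predT iter_addr_0 -!mulrA [X in _ <=
      X]mulr_natl.
  rewrite big_seq [X in _ <= X]big_seq; apply: ler_sum => h hms.
  apply: le_trans (nr_sum _ _) _.
  apply: (@le_trans _ _ (k * \sum_(N <= n < M) (1 + n%:R) ^- 2)); last first.
    rewrite -mulrA mulrCA; apply: ler_wpM2l => //.
    apply: le_trans (sum_inv_sqr NM) _.
    by rewrite gerDl oppr_le0 divr_ge0.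
  rewrite mulr_sumr; apply: ler_sum => n _.
  have h0 := ms_ge0 h hms; have n0 : 0 <= n%:R :> R by rewrite ler0n.
  rewrite ler_pdivlMr ?exprn_gt0 //.
  apply: le_trans (bk (h + n%:R) _); last exact: addr_ge0.
  by rewrite ler_wpM2l ?nr_ge0 // ler_pXn2r ?nnegrE //; lra.
have [y yS] := cauchy_seq Sb; exists y.
  apply/ler_addgt0Pr => e e0; have [N NP] := yS e e0.
  have := nrD (y - S N) (S N); rewrite subrK => /le_trans; apply.
  rewrite addrC; apply: lerD; last by apply/ltW/NP.
  have S0 : S 0%N = 0 by rewrite /S big1 // => h _; rewrite big_geq.
  by have := Sb 0%N N (leq0n N); rewrite S0 subr0 divr1.
move=> s v vs; have [->|v0] := eqVneq v 0; first by rewrite linear0 !dot0r.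
have [h hm [n sE]] := mwt_minw vs v0.
have Sv N : (n < N)%N -> hc_ip H (S N) (E v) = um_ip W (b s) v.
  move=> nN; rewrite /S dot_suml (bigD1_seq h) //=; last exact/msE.
  rewrite [X in _ + X]big_seq_cond [X in _ + X]big1 ?addr0; last first.
    move=> h' /andP [/msE h'm h'h]; rewrite dot_suml big1 // => n' _.
    rewrite hc_isometry; apply: mwt_orth (bw _) vs _; apply: contra h'h => /eqP.
    by rewrite sE => /(minw_inj h'm hm) ->.
  rewrite dot_suml (bigD1_seq n) ?iota_uniq //=; last by rewrite mem_index_iota.
  rewrite hc_isometry -sE big1 ?addr0 // => n' n'n.
  rewrite hc_isometry; apply: mwt_orth (bw _) vs _.
  by rewrite sE (inj_eq (addrI _)) eqr_nat.
apply/eqP; rewrite -subr_eq0; apply/eqP.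
apply: (nr_small (nr_ge0 (E v))) => e e0; have [N NP] := yS e e0.
rewrite -(Sv (maxn N n.+1)) ?leq_maxr // -dotBl.
apply: le_trans (hc_CS _ _) _; rewrite mulrC ler_wpM2l ?nr_ge0 // ltW //.
by apply: NP; rewrite leq_maxl.
Qed.

(** Two spare powers of 1 + s pay for the summability required by [family_vec]. *)
Lemma wk_fun f (m : R) k x z :
  wk_rel (fun s => ((1 + s) ^+ k)%:C) x z ->
  (forall s, 0 <= s -> nr (f s) * (1 + s) ^+ 2 <= m * (1 + s) ^+ k) ->
  exists y, wk_rel f x y.
Proof.
have [c _ cP] := family_vec; move=> xz fm.
have [P xP] := hc_proj x.
have Pz s : 0 <= s -> nrW (P s) * (1 + s) ^+ k <= nr z.
  move=> s0; have [Pw PE] := xP s.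
  have s1 : 0 <= (1 + s) ^+ k by apply: exprn_ge0; lra.
  have := @proj_nr z s (((1 + s) ^+ k)%:C *: P s).
  rewrite /nrW linearZ nrZ nr_real ger0_norm // mulrC; apply; first exact: mwtZ.
  by move=> u us; rewrite (xz s) // PE // dotZl.
have m0 : 0 <= m.
  have := fm 0 (lexx 0); rewrite addr0 !expr1n !mulr1.
  exact: le_trans (nr_ge0 _).
have [|s s0|y _ yE] := cP (fun s => f s *: P s) (m * nr z).
- by move=> s; apply: mwtZ; have [] := xP s.
- rewrite /nrW linearZ nrZ mulrAC; apply: le_trans (ler_wpM2r (nr_ge0 _) (fm s
  s0)) _.
  by rewrite -mulrA ler_wpM2l // mulrC Pz.
- exists y => s v vs; rewrite (yE s) // dotZl.
  by have [_ ->] := xP s.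
Qed.

(** Integer powers suffice: the real exponent r is rounded up, and two more powers are spent in
    [wk_fun]. *)
Lemma smooth_wk (x : H) : smooth_vectors H x <->
  forall k : nat, exists z, wk_rel (fun s => ((1 + s) ^+ k)%:C) x z.
Proof.
have s1 s : 0 <= s -> 1 <= 1 + s :> R by lra.
split=> [xs k|xs r r0].
  have [z /L0pow_wk /= xz] := xs k%:R (ler0n _ _); exists z.
  apply: wk_rel_eq xz => s s0; rewrite powR_mulrn //; lra.
pose n := (Num.truncn r).+1.
have [z xz] := xs (n + 2)%N.
have [|y xy] := @wk_fun (fun s => ((1 + s) `^ r)%:C) 1 _ _ _ xz.
  move=> s s0; rewrite nr_real ger0_norm ?powR_ge0 // mul1r exprD.
  rewrite ler_wpM2r ?sqr_ge0 // -powR_mulrn; last by lra.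
  by rewrite ler_powR ?s1 // ltW // truncnS_gt.
by exists y; apply/L0pow_wk.
Qed.

End Completion.

(** * Operators attached to rapidly decreasing forms *)

Section FormClosure.
Context (R : realType) (V : unitary_voa R) (Wj Wk : unitary_module V).
Context (Hj : completion Wj) (Hk : completion Wk).
Local Notation C := R[i].
Local Notation Ej := (hc_in Hj).
Local Notation Ek := (hc_in Hk).

Hypothesis minj : finite_set (minw Wj).
Hypothesis mink : finite_set (minw Wk).

Variable beta : Wj -> Wk -> C.
Hypothesis beta_l : forall u a v v',
  beta (a *: v + v') u = a * beta v u + beta v' u.
Hypothesis beta_r : forall v a u u',
  beta v (a *: u + u') = Num.conj a * beta v u + beta v u'.

(* The matrix entries of beta between weights la and mu decay faster than any
   power of one weight, up to a power of the other. *)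
Hypothesis beta_decayk : forall p : nat, exists (k : R) (n : nat), 0 <= k /\
  forall (la mu : R) v u, 0 <= la -> 0 <= mu -> mwt la v -> mwt mu u ->
  nr (beta v u) * (1 + mu) ^+ p <= k * (1 + la) ^+ n * nrW Hj v * nrW Hk u.
Hypothesis beta_decayj : forall p : nat, exists (k : R) (n : nat), 0 <= k /\
  forall (la mu : R) v u, 0 <= la -> 0 <= mu -> mwt la v -> mwt mu u ->
  nr (beta v u) * (1 + la) ^+ p <= k * (1 + mu) ^+ n * nrW Hj v * nrW Hk u.

(** An abstract [smeared_alg], with an arbitrary form in place of the smeared correlation. *)
Definition form_graph : set (Hj * Hk) := [set p | exists v : Wj,
  p.1 = Ej v /\ forall u : Wk, hc_ip Hk p.2 (Ek u) = beta v u].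

Let beta0l u : beta 0 u = 0.
Proof. by have := beta_l u (-1) 0 0; rewrite scaler0 addr0 mulN1r addNr. Qed.

Let beta0r v : beta v 0 = 0.
Proof. by have := beta_r v (-1) 0 0; rewrite scaler0 addr0 rmorphN rmorph1
  mulN1r addNr. Qed.

Let betaDl u v v' : beta (v + v') u = beta v u + beta v' u.
Proof. by have := beta_l u 1 v v'; rewrite scale1r mul1r. Qed.

Let betaDr v u u' : beta v (u + u') = beta v u + beta v u'.
Proof. by have := beta_r v 1 u u'; rewrite scale1r rmorph1 mul1r. Qed.

Let coef (s : R) (n : nat) : C := ((1 + s) ^+ n)%:C.

Lemma form_coef (mu : R) (u : Wk) : exists b : R -> Wj, forall la,
  mwt la (b la) /\ forall v, mwt la v -> beta v u = um_ip Wj v (b la).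
Proof.
have bP la : exists a, mwt la a /\ forall v, mwt la v ->
  beta v u = um_ip Wj v a.
  have [a aw aP] := @mwt_riesz _ _ _ la (beta^~ u) (beta_l u).
  by exists a.
by have [b bE] := choice bP; exists b.
Qed.

(** A decay estimate for [beta] tested on the vector that represents it bounds a squared norm; this
    cancels one factor. *)
Lemma sqr_cancel (x a b : R) : 0 <= x -> 0 <= b -> x ^+ 2 * a <= b * x ->
  x * a <= b.
Proof.
move=> x0 b0; have [->|xn0] := eqVneq x 0; first by rewrite mul0r.
by rewrite expr2 -mulrA [b * x]mulrC ler_pM2l // lt_neqAle eq_sym xn0.
Qed.

(** The vector is (1 + L_0)^(-m) applied to the adjoint vector of u. Of the m = n + 2 powers, [n]
    undo the growth in [la] and two serve [family_vec]; decay in [mu] remains. *)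
Lemma form_adjoint_coef p : exists (m : nat) (k : R), forall (mu : R) (u : Wk),
  0 <= mu -> mwt mu u -> exists a : Hj, nr a * (1 + mu) ^+ p <= k * nrW Hk u /\
  forall la v, mwt la v -> coef la m * hc_ip Hj (Ej v) a = beta v u.
Proof.
have [k [n [k0 kP]]] := beta_decayk p; have [c c0 cP] := family_vec Hj minj.
exists (n + 2)%N, (c * k) => mu u mu0 umu.
have [b bP] := form_coef mu u.
have mu1 : 0 < (1 + mu) ^+ p by apply: exprn_gt0; lra.
have [||y yk yE] := cP (fun la => ((1 + la) ^- (n + 2))%:C *: b la)
    (k * nrW Hk u / (1 + mu) ^+ p).
- by move=> s; apply: mwtZ; have [] := bP s.
- move=> s s0; have [bw bE] := bP s.
  have s1 : 0 < 1 + s by lra.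
  rewrite ler_pdivlMr // /nrW linearZ nrZ nr_real ger0_norm; last first.
    by rewrite invr_ge0 exprn_ge0 // ltW.
  have := kP s mu (b s) u s0 mu0 bw umu.
  rewrite bE // (nrWE Hj) nr_real ger0_norm ?sqr_ge0 // => le1.
  have {le1} : nrW Hj (b s) * (1 + mu) ^+ p <= k * (1 + s) ^+ n * nrW Hk u.
    apply: sqr_cancel; first exact: nr_ge0.
      by rewrite !mulr_ge0 ?nr_ge0 // exprn_ge0 // ltW.
    by rewrite [X in _ <= X]mulrAC.
  rewrite -/(nrW Hj (b s)); set X := nrW Hj (b s); rewrite exprD => le1.
  have -> : ((1 + s) ^+ n * (1 + s) ^+ 2)^-1 * X * (1 + s) ^+ 2 * (1 + mu) ^+
    p =
      X * (1 + mu) ^+ p / (1 + s) ^+ n.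
    by field; rewrite !expf_neq0 ?lt0r_neq0.
  by rewrite ler_pdivrMr ?exprn_gt0 // mulrAC.
exists y; split.
  by rewrite -ler_pdivlMr // -!mulrA; move: yk; rewrite -!mulrA.
move=> la v vla; have [->|v0] := eqVneq v 0; first by rewrite linear0 dot0l
  mulr0 beta0l.
have la0 := mwt_ge0 vla v0; have [bw bE] := bP la.
rewrite (dotC (hc_ip Hj)) (yE la) // -(dotC (um_ip Wj)) dotZr bE //.
rewrite -[Num.conj _]/(conjc _) conjc_real mulrA -realcM divff ?mul1r //.
by rewrite expf_neq0 // lt0r_neq0 //; lra.
Qed.

(** For homogeneous u, the components representing [beta] decay quadratically in [la], so they sum
    to a vector; additivity in u does the rest. *)
Lemma form_adjoint : exists a : Wk -> Hj,
  forall v u, hc_ip Hj (Ej v) (a u) = beta v u.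
Proof.
suff aP u : exists a, forall v, hc_ip Hj (Ej v) a = beta v u.
  by have [a aE] := choice aP; exists a.
elim/mwt_ind: u => [|u1 u2 [a1 a1E] [a2 a2E]|mu u umu].
- by exists 0 => v; rewrite dot0r beta0r.
- by exists (a1 + a2) => v; rewrite dotDr a1E a2E betaDr.
have [u0|u0] := eqVneq u 0; first by exists 0 => v; rewrite u0 dot0r beta0r.
have mu0 := mwt_ge0 umu u0.
have [k [n [k0 kP]]] := beta_decayj 2; have [c c0 cP] := family_vec Hj minj.
have [b bP] := form_coef mu u.
have [||y _ yE] := cP b (k * (1 + mu) ^+ n * nrW Hk u).
- by move=> s; have [] := bP s.
- move=> s s0; have [bw bE] := bP s.
  have := kP s mu (b s) u s0 mu0 bw umu.
  rewrite bE // (nrWE Hj) nr_real ger0_norm ?sqr_ge0 // => le1.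
  apply: sqr_cancel; first exact: nr_ge0.
    by rewrite !mulr_ge0 ?nr_ge0 // exprn_ge0 //; lra.
  by rewrite [X in _ <= X]mulrAC.
exists y; elim/mwt_ind => [|v1 v2 h1 h2|la v vla].
- by rewrite linear0 dot0l beta0l.
- by rewrite linearD dotDl h1 h2 betaDl.
- by rewrite (dotC (hc_ip Hj)) (yE la) // -(dotC (um_ip Wj)) (bP la).2.
Qed.

Section Adjoint.
Variable a : Wk -> Hj.
Hypothesis aE : forall v u, hc_ip Hj (Ej v) (a u) = beta v u.

Lemma adjoint_linear x c u u' :
  hc_ip Hj (a (c *: u + u')) x = c * hc_ip Hj (a u) x + hc_ip Hj (a u') x.
Proof.
have -> : a (c *: u + u') = c *: a u + a u'.
  apply: hc_ext => s v vs.
  rewrite dotDl dotZl !(dotC (hc_ip Hj) (a _)) !aE beta_r rmorphD rmorphM.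
  by rewrite /= conjCK.
by rewrite dotDl dotZl.
Qed.

(** With z = (1 + L_0)^m x and [a'] from [form_adjoint_coef], the pairing of x with [a u] is that of
    z with [a'], which decays in [mu]. *)
Lemma adjoint_bound p : exists (m : nat) (k : R), 0 <= k /\ forall x z,
  wk_rel (coef^~ m) x z -> forall (mu : R) (u : Wk), 0 <= mu -> mwt mu u ->
  nr (hc_ip Hj x (a u)) * (1 + mu) ^+ p <= k * nr z * nrW Hk u.
Proof.
have [m [k kP]] := form_adjoint_coef p; exists m, `|k|; split;
  first exact: normr_ge0.
move=> x z xz mu u mu0 umu; have [a' [a'k a'E]] := kP mu u mu0 umu.
have <- : hc_ip Hj z a' = hc_ip Hj x (a u).
  by apply: (wk_adjoint xz) => s v vs; rewrite aE (a'E s).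
have mu1 : 0 <= (1 + mu) ^+ p by apply: exprn_ge0; lra.
apply: le_trans (ler_wpM2r mu1 (hc_CS z a')) _.
have -> : `|k| * nr z * nrW Hk u = nr z * (`|k| * nrW Hk u) by ring.
rewrite -mulrA; apply: (ler_wpM2l (nr_ge0 z)).
by apply: le_trans a'k _; rewrite ler_wpM2r ?nr_ge0 // ler_norm.
Qed.

Lemma adjoint_comp x : exists b : R -> Wk, forall mu : R, mwt mu (b mu) /\
  forall u, mwt mu u -> hc_ip Hj x (a u) = um_ip Wk (b mu) u.
Proof.
have bP (mu : R) : exists b, mwt mu b /\
    forall u, mwt mu u -> hc_ip Hj x (a u) = um_ip Wk b u.
  have [b bw bE] := @mwt_riesz _ _ _ mu
    (fun u => hc_ip Hj (a u) x) (adjoint_linear x).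
  by exists b; split => // u umu; rewrite (dotC (hc_ip Hj)) bE // -dotC.
by have [b bE] := choice bP; exists b.
Qed.

Lemma comp_bound p : exists (m : nat) (k : R), 0 <= k /\ forall x z,
  wk_rel (coef^~ m) x z -> forall (mu : R) b, 0 <= mu -> mwt mu b ->
  (forall u, mwt mu u -> hc_ip Hj x (a u) = um_ip Wk b u) ->
  nrW Hk b * (1 + mu) ^+ p <= k * nr z.
Proof.
have [m [k [k0 kP]]] := adjoint_bound p; exists m, k; split => //.
move=> x z xz mu b mu0 bmu bE; have := kP x z xz mu b mu0 bmu.
rewrite bE // (nrWE Hk) nr_real ger0_norm ?sqr_ge0 //.
by apply: sqr_cancel; rewrite ?mulr_ge0 ?nr_ge0.
Qed.

(** Continuity of the operator from a Sobolev norm to the Hilbert norm: the components of the image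
    decay quadratically, so they sum to a vector. *)
Lemma smear_exists : exists (m : nat) (k : R), 0 <= k /\ forall x z,
  wk_rel (coef^~ m) x z -> exists2 y, nr y <= k * nr z &
  forall u, hc_ip Hk y (Ek u) = hc_ip Hj x (a u).
Proof.
have [m [k [k0 kP]]] := comp_bound 2; have [c c0 cP] := family_vec Hk mink.
exists m, (c * k); split; first exact: mulr_ge0.
move=> x z xz; have [b bP] := adjoint_comp x.
have [||y yk yE] := cP b (k * nr z).
- by move=> s; have [] := bP s.
- by move=> s s0; have [bw bE] := bP s; exact: kP xz _ _ s0 bw bE.
exists y; first by rewrite -mulrA.
have a0 u : hc_ip Hj x (a u) = Num.conj (hc_ip Hj (a u) x) by rewrite -dotC.
elim/mwt_ind => [|u1 u2 h1 h2|s u us].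
- rewrite linear0 dot0r a0; have := adjoint_linear x (-1) 0 0.
  by rewrite scaler0 addr0 mulN1r addNr => ->; rewrite rmorph0.
- rewrite linearD dotDr h1 h2 !a0; have := adjoint_linear x 1 u1 u2.
  by rewrite scale1r mul1r => ->; rewrite rmorphD.
- by rewrite (yE s) // (bP s).2.
Qed.

Lemma smear_smooth x y : smooth_vectors Hj x ->
  (forall u, hc_ip Hk y (Ek u) = hc_ip Hj x (a u)) -> smooth_vectors Hk y.
Proof.
move=> /(smooth_wk minj) xs yE; apply/(smooth_wk mink) => p.
have [m [k [k0 kP]]] := comp_bound (p + 2); have [c c0 cP] := family_vec Hk
  mink.
have [z xz] := xs m; have [b bP] := adjoint_comp x.
have [||t _ tE] := cP (fun s => coef s p *: b s) (k * nr z).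
- by move=> s; apply: mwtZ; have [] := bP s.
- move=> s s0; have [bw bE] := bP s.
  rewrite /nrW linearZ nrZ nr_real ger0_norm; last by apply: exprn_ge0; lra.
  by rewrite mulrC mulrA [X in X <= _]mulrC -exprD addnC;
    exact: kP xz _ _ s0 bw bE.
exists t => s v vs; rewrite (tE s) // dotZl yE.
by have [_ ->] := bP s.
Qed.

(** This yields closability: the adjoint vectors determine y from x. *)
Lemma form_graph_adjoint x y : closure form_graph (x, y) ->
  forall u, hc_ip Hk y (Ek u) = hc_ip Hj x (a u).
Proof.
move=> /closure_graph xy u; apply/eqP; rewrite -subr_eq0; apply/eqP.
apply: (@nr_small R _ _ (nrW Hk u + nr (a u)));
  first by rewrite addr_ge0 ?nr_ge0.
move=> e e0; have [q [v [qE qu]] /= [q1 q2]] := xy e e0.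
have -> : hc_ip Hk y (Ek u) - hc_ip Hj x (a u) =
    hc_ip Hk (y - q.2) (Ek u) - hc_ip Hj (x - q.1) (a u).
  by rewrite !dotBl qu qE aE opprB addrA subrK.
apply: le_trans (nrD _ _) _; rewrite nrN mulrDl.
by apply: lerD; apply: le_trans (hc_CS _ _) _;
  rewrite mulrC ler_wpM2l ?nr_ge0 // ltW.
Qed.

(** Truncations [v] of x converge together with (1 + L_0)^m v, and [smear_exists] then makes the
    image of x - v small. *)
Lemma adjoint_form_graph x y : smooth_vectors Hj x ->
  (forall u, hc_ip Hk y (Ek u) = hc_ip Hj x (a u)) -> closure form_graph (x, y).
Proof.
move=> /(smooth_wk minj) xs yE; apply/closure_graph => e e0.
have [m [k [k0 kP]]] := smear_exists; have [z xz] := xs m.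
(* Adding 1 allows k = 0 and keeps k * d strictly below [e]. *)
pose d := e / (k + 1).
have d0 : 0 < d by rewrite divr_gt0 //; lra.
have de : k * d < e.
  by rewrite /d mulrCA gtr_pMr // ltr_pdivrMr ?mul1r; lra.
have r0 : 0 < Num.min d e by rewrite lt_min d0 e0.
have [l [P [Pw]]] := wk_approx xz r0.
rewrite !lt_min => /andP [_ xe] /andP [ze _].
set v := \sum_(s <- l) P s in xe; set v' := \sum_(s <- l) _ in ze.
have vv' : wk_rel (coef^~ m) (Ej v) (Ej v') by exact: wk_rel_sum.
have [|y' y'k y'E] := kP (x - Ej v) (z - Ej v').
  by have := wk_relD xz (wk_relZ (-1) vv'); rewrite !scaleN1r.
exists (Ej v, y - y'); last first.
  split=> //=; rewrite opprB addrC subrK.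
  apply: le_lt_trans y'k _; apply: le_lt_trans de.
  by rewrite ler_wpM2l // ltW.
exists v; split=> // u /=.
by rewrite dotBl yE y'E dotBl opprB addrC subrK aE.
Qed.

End Adjoint.

Lemma form_graph_closure : exists a : Wk -> Hj,
  (forall v u, hc_ip Hj (Ej v) (a u) = beta v u) /\
  forall x, smooth_vectors Hj x -> exists y,
    [/\ smooth_vectors Hk y, forall u, hc_ip Hk y (Ek u) = hc_ip Hj x (a u) &
      forall z, [/\ closure form_graph (x, z), smooth_vectors Hj x &
        smooth_vectors Hk z] <-> z = y].
Proof.
have [a aE] := form_adjoint; exists a; split=> // x xs.
have [m [k [_ kP]]] := smear_exists aE.
have /(smooth_wk minj) /(_ m) [z xz] := xs.
have [y _ yE] := kP x z xz.
have ys := smear_smooth aE xs yE.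
exists y; split=> // t; split=> [[xt _ _]|->].
  apply: hc_ext => s u _; rewrite yE; exact: form_graph_adjoint xt u.
by split=> //; exact: adjoint_form_graph.
Qed.

End FormClosure.

(** * Fourier coefficients of flat functions *)

Section RealFourier.
Variable R : realType.
Implicit Types (f g u v : R -> R) (a b s : R).

Local Notation Int a b f := (\int[lebesgue_measure]_(x in `[a, b]) f x)%R.

Lemma contM f g : continuous f -> continuous g ->
  continuous (fun x => f x * g x).
Proof. by move=> fc gc x; exact: continuousM (fc x) (gc x). Qed.

Lemma contD f g : continuous f -> continuous g ->
  continuous (fun x => f x + g x).
Proof. by move=> fc gc x; exact: continuousD (fc x) (gc x). Qed.

Lemma contZ (k : R) f : continuous f -> continuous (fun x => k * f x).
Proof. by move=> fc; apply: contM => // x; exact: cvg_cst. Qed.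

Lemma cont_shift f t : continuous f -> continuous (fun x => f (x - t)).
Proof.
move=> fc x; apply: (@continuous_comp _ _ _ (fun y : R => y - t) f);
  last exact: fc.
by apply: (@cvgB _ R^o); [exact: cvg_id|exact: cvg_cst].
Qed.

Lemma cont_integrable f a b : continuous f ->
  lebesgue_measure.-integrable `[a, b] (EFin \o f).
Proof.
move=> fc; apply: continuous_compact_integrable; first exact: segment_compact.
exact: continuous_subspaceT.
Qed.

Lemma Int_lin f g (c d : R) a b : continuous f -> continuous g ->
  Int a b (fun x => c * f x + d * g x) = c * Int a b f + d * Int a b g.
Proof.
move=> fc gc; 
rewrite RintegralD //; [|exact: cont_integrable (contZ fc)|exact:
  cont_integrable (contZ gc)].
by rewrite !RintegralZl //; exact: cont_integrable.
Qed.

Lemma derivable_cont f : (forall x, derivable f x 1) -> continuous f.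
Proof. by move=> df x; exact/differentiable_continuous/derivable1_diffP. Qed.

Lemma derivable_LR f a b : (forall x, a <= x -> derivable f x 1) -> a <= b ->
  derivable_oo_LRcontinuous f a b.
Proof.
move=> df ab.
have fc x : a <= x -> {for x, continuous f}.
  by move=> ax; exact/differentiable_continuous/derivable1_diffP/df.
split=> [x|//|].
- by rewrite in_itv /= => /andP [ax _]; apply: df; exact: ltW.
- exact/cvg_at_right_filter/fc.
- exact/cvg_at_left_filter/fc.
Qed.

Lemma continuous_FTC f (F : R -> R) a b : a <= b -> continuous f ->
  (forall x, a <= x -> derivable F x 1) -> (forall x, a <= x ->
    derive1 F x = f x) ->
  Int a b f = F b - F a.
Proof.
rewrite le_eqVlt => /orP [/eqP -> fc dF FE|ab fc dF FE].
  by rewrite set_itv1 Rintegral_set1 subrr.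
rewrite /Rintegral (@continuous_FTC2 _ f F) //.
- exact: continuous_subspaceT.
- by apply: derivable_LR => //; exact: ltW.
- by move=> x; rewrite in_itv /= => /andP [ax _]; apply: FE; exact: ltW.
Qed.

Lemma primitive f a : continuous f -> exists F : R -> R, forall x, a < x ->
  derivable F x 1 /\ derive1 F x = f x.
Proof.
move=> fc; exists (fun x => Int a x f) => x ax.
have xx : x < x + 1 by lra.
have [] := @continuous_FTC1_closed _ f a x (x + 1) xx _ ax (fc x).
  exact: cont_integrable.
by [].
Qed.

(** A primitive of f is constant within |t| of both endpoints, so shifting the interval does not
    change the integral. *)
Lemma int_shift f t : continuous f ->
  (forall y, pi - `|t| <= y <= pi + `|t| -> f y = 0) ->
  (forall y, - pi - `|t| <= y <= - pi + `|t| -> f y = 0) ->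
  Int (- pi) pi (fun x => f (x - t)) = Int (- pi) pi f.
Proof.
(* The base point lies strictly left of every point used, so that the primitive is differentiable at
   all of them. *)
move=> fc fp fm; have [F FP] := primitive (- pi - `|t| - 1) fc.
have FB c d : - pi - `|t| <= c -> c <= d -> Int c d f = F d - F c.
  move=> pc cd; apply: continuous_FTC => // x cx.
    by have [|] := FP x; first by lra.
  by have [|] := FP x; first by lra.
have F0 c d : - pi - `|t| <= c -> c <= d -> (forall y, c <= y <= d ->
  f y = 0) -> F d = F c.
  move=> pc cd f0; apply/eqP; rewrite -subr_eq0 -FB //; apply/eqP.
  rewrite (@eq_Rintegral _ _ _ _ _ (cst 0)); first by rewrite Rintegral_cst //
    mul0r.
  by move=> y; rewrite inE /= in_itv /= => /f0.
have p0 := @pi_gt0 R; have t1 := ler_norm t; have t2 := ler_norm (- t).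
rewrite normrN in t2; have t0 := normr_ge0 t.
have Fp : F (pi - t) = F pi.
  by rewrite (F0 (pi - `|t|) (pi - t)) ?(F0 (pi - `|t|) pi) //; try lra;
    move=> y hy; apply: fp; lra.
have Fm : F (- pi - t) = F (- pi).
  by rewrite (F0 (- pi - `|t|) (- pi - t)) ?(F0 (- pi - `|t|) (- pi)) //;
    try lra; move=> y hy; apply: fm; lra.
have shift_derive (x : R) : - pi <= x ->
    derivable (fun y : R => F (y - t)) x 1 /\
      derive1 (fun y : R => F (y - t)) x = f (x - t).
  move=> px; have [|dF eF] := FP (x - t); first by lra.
  have hF : is_derive (x - t) (1 : R) F (f (x - t)).
    by apply: DeriveDef => //; rewrite -derive1E.
  have hs : is_derive x (1 : R) (fun y : R => y - t) 1.
    have := is_deriveB (is_derive_id x (1 : R)) (is_derive_cst t x (1 : R)).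
    by rewrite subr0.
  have [d e] := @is_derive1_comp R F (fun y => y - t) x _ _ hF hs.
  by split; [exact: d|rewrite derive1E e mulr1].
rewrite (FB (- pi) pi) -?Fp -?Fm; try lra.
apply: (@continuous_FTC _ (fun x => F (x - t))); first by lra.
- exact: cont_shift.
- by move=> x px; have [|d e] := shift_derive x; first by lra.
- by move=> x px; have [|d e] := shift_derive x; first by lra.
Qed.

Lemma int_parts f g a b : a < b ->
  (forall x, derivable f x 1) -> (forall x, derivable g x 1) ->
  continuous (derive1 f) -> continuous (derive1 g) ->
  Int a b (fun x => f x * derive1 g x) =
  f b * g b - f a * g a - Int a b (fun x => derive1 f x * g x).
Proof.
move=> ab df dg f'c g'c.
have fLR : derivable_oo_LRcontinuous f a b by apply: derivable_LR; rewrite ?ltW.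
have gLR : derivable_oo_LRcontinuous g a b by apply: derivable_LR; rewrite ?ltW.
exact: (Rintegration_by_parts ab (continuous_subspaceT f'c) fLR
  (fun x _ => erefl (derive1 f x)) (continuous_subspaceT g'c) gLR
  (fun x _ => erefl (derive1 g x))).
Qed.

Lemma is_derive_mulrl s x : is_derive x (1 : R) (fun y : R => s * y) s.
Proof.
have := is_deriveZ s (is_derive_id x (1 : R)).
by rewrite -[s *: (1 : R)]/(s * 1) mulr1.
Qed.

Lemma cos_lin_derive s x : derivable (fun y : R => cos (s * y)) x 1 /\
  derive1 (fun y : R => cos (s * y)) x = - s * sin (s * x).
Proof.
have [d e] := is_derive1_comp (is_derive_cos (s * x)) (is_derive_mulrl s x).
by split; [exact: d|rewrite derive1E e mulrC mulNr mulrN].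
Qed.

Lemma sin_lin_derive s x : derivable (fun y : R => sin (s * y)) x 1 /\
  derive1 (fun y : R => sin (s * y)) x = s * cos (s * x).
Proof.
have [d e] := is_derive1_comp (is_derive_sin (s * x)) (is_derive_mulrl s x).
by split; [exact: d|rewrite derive1E e mulrC].
Qed.

Lemma cos_lin_cont s : continuous (fun y : R => cos (s * y)).
Proof. by apply: derivable_cont => x; have [] := cos_lin_derive s x. Qed.

Lemma sin_lin_cont s : continuous (fun y : R => sin (s * y)).
Proof. by apply: derivable_cont => x; have [] := sin_lin_derive s x. Qed.

Definition fcos u s := Int (- pi) pi (fun x => u x * cos (s * x)).
Definition fsin u s := Int (- pi) pi (fun x => u x * sin (s * x)).

Lemma ltNpipi : - pi < pi :> R.
Proof. by have := @pi_gt0 R; lra. Qed.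

Lemma fcos_derive u s : (forall x, derivable u x 1) -> continuous (derive1 u) ->
  u pi = 0 -> u (- pi) = 0 -> fcos (derive1 u) s = s * fsin u s.
Proof.
move=> du u'c up um.
have := @int_parts u (fun y : R => cos (s * y)) _ _ ltNpipi du.
rewrite up um !mul0r subr0 sub0r => e.
rewrite /fcos -[LHS]opprK -e.
- have -> : (fun x => u x * derive1 (fun y : R => cos (s * y)) x) =
      (fun x => - s * (u x * sin (s * x)) + 0 * u x).
    by apply/funext => x; rewrite (cos_lin_derive s x).2; ring.
  have uc := derivable_cont du.
  rewrite Int_lin ?mul0r ?addr0 ?mulNr ?opprK //.
  by apply: contM => //; exact: sin_lin_cont.
- by move=> x; have [] := cos_lin_derive s x.
- by [].
- have -> : derive1 (fun y : R => cos (s * y)) = (fun x => - s * sin (s * x)).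
    by apply/funext => x; rewrite (cos_lin_derive s x).2.
  by apply: contZ; exact: sin_lin_cont.
Qed.

Lemma fsin_derive u s : (forall x, derivable u x 1) -> continuous (derive1 u) ->
  u pi = 0 -> u (- pi) = 0 -> fsin (derive1 u) s = - s * fcos u s.
Proof.
move=> du u'c up um.
have := @int_parts u (fun y : R => sin (s * y)) _ _ ltNpipi du.
rewrite up um !mul0r subr0 sub0r => e.
rewrite /fsin -[LHS]opprK -e.
- have -> : (fun x => u x * derive1 (fun y : R => sin (s * y)) x) =
      (fun x => s * (u x * cos (s * x)) + 0 * u x).
    by apply/funext => x; rewrite (sin_lin_derive s x).2; ring.
  have uc := derivable_cont du.
  rewrite Int_lin ?mul0r ?addr0 ?mulNr //.
  by apply: contM => //; exact: cos_lin_cont.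
- by move=> x; have [] := sin_lin_derive s x.
- by [].
- have -> : derive1 (fun y : R => sin (s * y)) = (fun x => s * cos (s * x)).
    by apply/funext => x; rewrite (sin_lin_derive s x).2.
  by apply: contZ; exact: cos_lin_cont.
Qed.

Lemma fcos_lin u v c d s : continuous u -> continuous v ->
  fcos (fun x => c * u x + d * v x) s = c * fcos u s + d * fcos v s.
Proof.
move=> uc vc; rewrite /fcos -Int_lin; try by apply: contM => //;
  exact: cos_lin_cont.
by congr Rintegral; apply/funext => x; ring.
Qed.

Lemma fsin_lin u v c d s : continuous u -> continuous v ->
  fsin (fun x => c * u x + d * v x) s = c * fsin u s + d * fsin v s.
Proof.
move=> uc vc; rewrite /fsin -Int_lin; try by apply: contM => //;
  exact: sin_lin_cont.
by congr Rintegral; apply/funext => x; ring.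
Qed.

Lemma int_bound u (c : R -> R) : continuous u -> continuous c ->
  (forall x, `|c x| <= 1) ->
  `|Int (- pi) pi (fun x => u x * c x)| <= Int (- pi) pi (fun x => `|u x|).
Proof.
move=> uc cc c1; have ucc := contM uc cc.
have nc f : continuous f -> continuous (fun x => `|f x|).
  by move=> fc x; exact: (cvg_norm (fc x)).
apply: (le_trans (le_normr_Rintegral _ _)) => //; first exact: cont_integrable.
apply: le_Rintegral => //.
- by apply: cont_integrable; exact: nc.
- by apply: cont_integrable; exact: nc.
by move=> x _; rewrite normrM ler_piMr.
Qed.

(** Vanishing near the cut. For real frequencies s the kernel is not 2 pi-periodic, so boundary
    terms disappear only because u vanishes at both ends. *)
Definition flat (e : R) u := forall x, `|x - pi| < e \/ `|x + pi| < e ->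
  u x = 0.

Lemma flat_derive e u : flat e u -> flat e (derive1 u).
Proof.
move=> u0 x xe; rewrite derive1E (@near_eq_derive _ _ _ u (cst 0)).
  exact: derive_cst.
case: xe => xe; apply/nbhs_ballP.
  exists (e - `|x - pi|); first by rewrite /= subr_gt0.
  move=> y; rewrite -ball_normE /= => xy; apply: u0; left.
  have -> : y - pi = (y - x) + (x - pi) by ring.
  by apply: le_lt_trans (ler_normD _ _) _; rewrite distrC -ltrBrDr.
exists (e - `|x + pi|); first by rewrite /= subr_gt0.
move=> y; rewrite -ball_normE /= => xy; apply: u0; right.
have -> : y + pi = (y - x) + (x + pi) by ring.
by apply: le_lt_trans (ler_normD _ _) _; rewrite distrC -ltrBrDr.
Qed.

Lemma smooth_derive u : smooth u -> smooth (derive1 u).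
Proof. by move=> us n x; rewrite -derive1Sn. Qed.

Lemma smooth_derivable u : smooth u -> forall x, derivable u x 1.
Proof. by move=> us x; exact: (us 0%N x). Qed.

Lemma smooth_cont u : smooth u -> continuous u.
Proof. by move=> us; apply: derivable_cont; exact: smooth_derivable. Qed.

(** Each factor 1 + |s| splits into a bound for u and one for its derivative, integration by parts
    exchanging the cosine and sine coefficients. *)
Lemma fourier_decay e n : 0 < e -> forall u, smooth u -> flat e u ->
  exists2 C : R, 0 <= C & forall s,
    `|fcos u s| * (1 + `|s|) ^+ n <= C /\ `|fsin u s| * (1 + `|s|) ^+ n <= C.
Proof.
move=> e0; elim: n => [|n IHn] u us u0.
  exists (Int (- pi) pi (fun x => `|u x|)); first exact: Rintegral_ge0.
  have uc := smooth_cont us.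
  move=> s; rewrite !expr0 !mulr1; split; apply: int_bound => //.
  - exact: cos_lin_cont.
  - move=> x; rewrite ler_norml; apply/andP; split;
    [exact: cos_geN1|exact: cos_le1].
  - exact: sin_lin_cont.
  - move=> x; rewrite ler_norml; apply/andP; split;
    [exact: sin_geN1|exact: sin_le1].
have [C C0 CP] := IHn u us u0.
have [D D0 DP] := IHn _ (smooth_derive us) (flat_derive u0).
have du := smooth_derivable us; have u'c := smooth_cont (smooth_derive us).
have up : u pi = 0 by apply: u0; left; rewrite subrr normr0.
have um : u (- pi) = 0 by apply: u0; right; rewrite addNr normr0.
exists (C + D); first exact: addr_ge0.
move=> s; have [C1 C2] := CP s; have [D1 D2] := DP s.
rewrite exprS !mulrA !mulrDr !mulr1 !mulrDl.
split; apply: lerD => //.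
- by move: D2; rewrite fsin_derive // normrM normrN [`|s| * _]mulrC.
- by move: D1; rewrite fcos_derive // normrM [`|s| * _]mulrC.
Qed.

End RealFourier.

Section ComplexFourier.
Variable R : realType.
Local Notation C := R[i].
Implicit Types (F G : R -> C) (s x : R).

Definition ccont F := continuous (fun x => complex.Re (F x)) /\
  continuous (fun x => complex.Im (F x)).

Lemma cisD x y : cis (x + y) = cis x * cis y.
Proof. by apply/eqP; rewrite eq_complex /= cosD sinD [X in _ && (_ == X)]addrC
  !eqxx. Qed.

Lemma cintegral_lin (a : C) F G p q : ccont F -> ccont G ->
  cintegral p q (fun x => a * F x + G x) = a * cintegral p q F + cintegral p q
    G.
Proof.
move=> [F1 F2] [G1 G2]; rewrite /cintegral.
have lin (c d : R) (f g h : R -> R) : continuous f -> continuous g ->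
  continuous h ->
    (\int[lebesgue_measure]_(x in `[p, q]) (c * f x + d * g x + h x))%R =
    c * (\int[lebesgue_measure]_(x in `[p, q]) f x)%R
    + d * (\int[lebesgue_measure]_(x in `[p, q]) g x)%R
    + (\int[lebesgue_measure]_(x in `[p, q]) h x)%R.
  move=> fc gc hc; have fgc := contD (contZ (k := c) fc) (contZ (k := d) gc).
  have := @Int_lin R (fun x => c * f x + d * g x) h 1 1 p q fgc hc.
  rewrite !mul1r -(Int_lin c d p q fc gc) => <-.
  by congr Rintegral; apply/funext => x; rewrite !mul1r.
have -> : (fun x => complex.Re (a * F x + G x)) = (fun x =>
  complex.Re a * complex.Re (F x)
    + (- complex.Im a) * complex.Im (F x) + complex.Re (G x)).
  by apply/funext => x; case: a (F x) (G x) => [? ?] [? ?] [? ?] /=; ring.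
have -> : (fun x => complex.Im (a * F x + G x)) = (fun x =>
  complex.Re a * complex.Im (F x)
    + complex.Im a * complex.Re (F x) + complex.Im (G x)).
  by apply/funext => x; case: a (F x) (G x) => [? ?] [? ?] [? ?] /=; ring.
rewrite !lin //; case: a => a1 a2 /=.
by apply/eqP; rewrite eq_complex /=; apply/andP; split; apply/eqP; ring.
Qed.

Lemma ccont_lin (a : C) F G : ccont F -> ccont G ->
  ccont (fun x => a * F x + G x).
Proof.
move=> [F1 F2] [G1 G2]; split.
  rewrite (_ : (fun x => _) = (fun x => complex.Re a * complex.Re (F x)
    + (- complex.Im a) * complex.Im (F x) + complex.Re (G x))).
    by apply: contD => //; apply: contD; exact: contZ.
  by apply/funext => x; case: a (F x) (G x) => [? ?] [? ?] [? ?] /=; ring.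
rewrite (_ : (fun x => _) = (fun x => complex.Re a * complex.Im (F x)
  + complex.Im a * complex.Re (F x) + complex.Im (G x))).
  by apply: contD => //; apply: contD; exact: contZ.
by apply/funext => x; case: a (F x) (G x) => [? ?] [? ?] [? ?] /=; ring.
Qed.

(** The smearing integrand for the mode s; the two exponentials combine to e^(-isx). *)
Definition kern F s x : C := cis (x * (- s - 1)) * F x * (cis x / (2 * pi)%:C).

Lemma kernE F s x : kern F s x =
  ((2 * pi)^-1 * (complex.Re (F x) * cos (s * x))
   + (2 * pi)^-1 * (complex.Im (F x) * sin (s * x))) +i*
  ((2 * pi)^-1 * (complex.Im (F x) * cos (s * x))
   + (- (2 * pi)^-1) * (complex.Re (F x) * sin (s * x))).
Proof.
have -> : kern F s x = ((2 * pi)^-1)%:C * (cis (- (s * x)) * F x).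
  have -> : - (s * x) = x * (- s - 1) + x by ring.
  by rewrite /kern cisD fmorphV /=; ring.
rewrite /cis cosN sinN; case: (F x) => u v /=.
by apply/eqP; rewrite eq_complex /=; apply/andP; split; apply/eqP; ring.
Qed.

Lemma kern_cont F s : ccont F -> ccont (kern F s).
Proof.
move=> [F1 F2]; split.
  rewrite (_ : (fun x => _) = (fun x =>
    (2 * pi)^-1 * (complex.Re (F x) * cos (s * x))
    + (2 * pi)^-1 * (complex.Im (F x) * sin (s * x)))); last first.
    by apply/funext => x; rewrite kernE.
  by apply: contD; apply: contZ; apply: contM => //;
    [exact: cos_lin_cont|exact: sin_lin_cont].
rewrite (_ : (fun x => _) = (fun x =>
  (2 * pi)^-1 * (complex.Im (F x) * cos (s * x))
  + (- (2 * pi)^-1) * (complex.Re (F x) * sin (s * x)))); last first.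
  by apply/funext => x; rewrite kernE.
by apply: contD; apply: contZ; apply: contM => //;
  [exact: cos_lin_cont|exact: sin_lin_cont].
Qed.

Definition hat F s : C := cintegral (- pi) pi (kern F s).

Lemma hatE F s : ccont F -> hat F s =
  ((2 * pi)^-1 * (fcos (fun x => complex.Re (F x)) s
                  + fsin (fun x => complex.Im (F x)) s)) +i*
  ((2 * pi)^-1 * (fcos (fun x => complex.Im (F x)) s
                  - fsin (fun x => complex.Re (F x)) s)).
Proof.
move=> [F1 F2]; rewrite /hat /cintegral.
under [X in X +i* _]eq_Rintegral do rewrite kernE /=.
under [X in _ +i* X]eq_Rintegral do rewrite kernE /=.
rewrite !Int_lin; try (by apply: contM => //; [exact: cos_lin_cont]);
  try (by apply: contM => //; [exact: sin_lin_cont]).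
rewrite /fcos /fsin; move: ((2 * pi)^-1) => k.
by rewrite mulrBr mulrDr mulNr.
Qed.

Lemma hat_decay F (e : R) (n : nat) : 0 < e ->
  smooth (fun x => complex.Re (F x)) -> smooth (fun x => complex.Im (F x)) ->
  flat e (fun x => complex.Re (F x)) -> flat e (fun x => complex.Im (F x)) ->
  exists2 k : R, 0 <= k & forall s, nr (hat F s) * (1 + `|s|) ^+ n <= k.
Proof.
move=> e0 s1 s2 f1 f2.
have [k1 k10 k1P] := fourier_decay n e0 s1 f1.
have [k2 k20 k2P] := fourier_decay n e0 s2 f2.
have pp : 0 <= (2 * pi)^-1 :> R by rewrite invr_ge0 mulr_ge0 // pi_ge0.
exists ((2 * pi)^-1 * (2 * k1 + 2 * k2)); first by apply: mulr_ge0 => //; lra.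
move=> s; have [a1 a2] := k1P s; have [b1 b2] := k2P s.
rewrite hatE; last by split; exact: smooth_cont.
set m := (1 + `|s|) ^+ n in a1 a2 b1 b2 *.
have m0 : 0 <= m by rewrite exprn_ge0 // addr_ge0.
have nrc (p q : R) : nr (p +i* q : C) <= `|p| + `|q|.
  have -> : p +i* q = p%:C + (0 +i* 1) * q%:C :> C.
    by apply/eqP; rewrite eq_complex /=; apply/andP; split; apply/eqP; ring.
  apply: le_trans (nrD _ _) _; rewrite nrM !nr_real lerD2l.
  by rewrite /nr normc_def /= expr0n expr1n add0r sqrtr1 mul1r.
apply: le_trans (ler_wpM2r m0 (nrc _ _)) _.
rewrite !normrM (ger0_norm pp) -mulrDr -mulrA; apply: ler_wpM2l => //.
apply: (@le_trans _ _ ((`|fcos (fun x => complex.Re (F x)) s| +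
   `|fsin (fun x => complex.Im (F x)) s| + (
     `|fcos (fun x => complex.Im (F x)) s| +
   `|fsin (fun x => complex.Re (F x)) s|)) * m)).
  by apply: ler_wpM2r => //; apply: lerD; [exact: ler_normD|exact: ler_normB].
by rewrite !mulrDl; lra.
Qed.

Lemma hatZ (a : C) F s : ccont F -> hat (fun x => a * F x) s = a * hat F s.
Proof.
move=> Fc; rewrite /hat.
have c0 : ccont (fun=> 0) by split=> x; exact: cvg_cst.
have := cintegral_lin a (- pi) pi (kern_cont s Fc) c0.
have -> : cintegral (- pi) pi (fun=> 0) = 0 :> C.
  by rewrite /cintegral /= Rintegral_cst // mul0r.
rewrite addr0 => <-; congr cintegral; apply/funext => x.
by rewrite addr0 /kern; ring.
Qed.

(** Integration by parts multiplies the coefficient by is, and the factor i in front of the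
    derivative turns this into -s. *)
Lemma hat_derive F s (e D : R) : 0 < e ->
  smooth (fun x => complex.Re (F x)) -> smooth (fun x => complex.Im (F x)) ->
  flat e (fun x => complex.Re (F x)) -> flat e (fun x => complex.Im (F x)) ->
  hat (fun x => D%:C * F x + (0 +i* 1) *
    (derive1 (fun y => complex.Re (F y)) x +i*
      derive1 (fun y => complex.Im (F y)) x)) s
  = (D - s)%:C * hat F s.
Proof.
move=> e0; set u := fun x => complex.Re (F x);
  set v := fun x => complex.Im (F x).
move=> us vs u0 v0.
have uc := smooth_cont us; have vc := smooth_cont vs.
have u'c := smooth_cont (smooth_derive us); have v'c := smooth_cont
  (smooth_derive vs).
set G := (fun x => D%:C * F x + _).
have GRe : (fun x => complex.Re (G x)) = (fun x =>
  D * u x + (-1) * derive1 v x).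
  by apply/funext => x; rewrite /G /u /v; case: (F x) => ? ? /=; ring.
have GIm : (fun x => complex.Im (G x)) = (fun x => D * v x + 1 * derive1 u x).
  by apply/funext => x; rewrite /G /u /v; case: (F x) => ? ? /=; ring.
rewrite hatE; last by rewrite /ccont GRe GIm; split; apply: contD; exact: contZ.
rewrite (@hatE F) // GRe GIm !fcos_lin // !fsin_lin //.
have pz w : flat e w -> w pi = 0 /\ w (- pi) = 0.
  by move=> w0; split; apply: w0; [left|right]; rewrite ?subrr ?addNr normr0.
have [up um] := pz u u0; have [vp vm] := pz v v0.
have du := smooth_derivable us; have dv := smooth_derivable vs.
rewrite (fcos_derive s du u'c up um) (fcos_derive s dv v'c vp vm).
rewrite (fsin_derive s du u'c up um) (fsin_derive s dv v'c vp vm).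
by apply/eqP; rewrite eq_complex /=; apply/andP; split; apply/eqP; ring.
Qed.

Lemma hat_shift F s (t : R) : ccont F ->
  (forall y, pi - `|t| <= y <= pi + `|t| -> F y = 0) ->
  (forall y, - pi - `|t| <= y <= - pi + `|t| -> F y = 0) ->
  hat (fun x => F (x - t)) s = cis (- (s * t)) * hat F s.
Proof.
move=> Fc fp fm; rewrite /hat.
have kE : kern (fun x => F (x - t)) s = fun x =>
  cis (- (s * t)) * kern F s (x - t).
  apply/funext => x; rewrite /kern.
  have -> : cis (x * (- s - 1)) = cis (- (s * t)) * cis (- t) * cis ((x - t) *
    (- s - 1)).
    by rewrite -!cisD; congr cis; ring.
  have -> : cis x = cis t * cis (x - t) by rewrite -cisD addrC subrK.
  (* Shifting the two exponentials of the kernel separately produces e^(-it) and e^(it), which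
     cancel. *)
  have tt : cis (- t) * cis t = 1 :> C.
    by rewrite -cisD addNr /cis cos0 sin0.
  rewrite -[RHS]mul1r -tt; ring.
rewrite kE.
have c0 : ccont (fun=> 0) by split=> x; exact: cvg_cst.
have [k1 k2] := kern_cont s Fc.
have sc : ccont (fun x => kern F s (x - t)).
  by split; [exact: (cont_shift (t := t) k1)|exact: (cont_shift (t := t) k2)].
have := cintegral_lin (cis (- (s * t))) (- pi) pi sc c0.
have -> : cintegral (- pi) pi (fun=> 0) = 0 :> C.
  by rewrite /cintegral /= Rintegral_cst // mul0r.
rewrite addr0; under [X in cintegral _ _ X]funext do rewrite addr0.
move=> ->; congr (_ * _); rewrite /cintegral.
have kz y : F y = 0 -> kern F s y = 0 by move=> Fy;
  rewrite /kern Fy mulr0 mul0r.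
congr (_ +i* _).
  by apply: (int_shift k1) => y hy; rewrite kz //; [exact: fp|exact: fm].
by apply: (int_shift k2) => y hy; rewrite kz //; [exact: fp|exact: fm].
Qed.

End ComplexFourier.

(** * The smeared intertwining operator *)

Section TestFunctions.
Variable R : realType.
Local Notation C := R[i].

Lemma e_iD (x t : R) : e_i (x + t) = rotS1 t (e_i x).
Proof. by apply: val_inj; rewrite /= addrC cisD. Qed.

Lemma cis_pi : cis pi = -1 :> C.
Proof. by rewrite /cis cospi sinpi; apply/eqP;
  rewrite eq_complex /= oppr0 !eqxx. Qed.

Lemma cis_Npi : cis (- pi) = -1 :> C.
Proof. by rewrite /cis cosN sinN cospi sinpi oppr0; apply/eqP;
  rewrite eq_complex /= oppr0 !eqxx. Qed.

Variables (J : set (S1 R)) (eps : R) (g : S1 R -> C).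
Hypothesis eps0 : 0 < eps.
Hypothesis rot_J : forall s : R, - eps < s < eps ->
  rotS1 s @` J `<=` @cut_circle R.
Hypothesis g_test : test_fun J g.

Local Notation F := (fun x => g (e_i x)).

Lemma test_smooth : smooth (fun x => complex.Re (F x)) /\
  smooth (fun x => complex.Im (F x)).
Proof. by have [] := g_test. Qed.

Lemma test_ccont : ccont F.
Proof. by have [su sv] := test_smooth; split; exact: smooth_cont. Qed.

(** A point that a rotation by less than [eps] carries to -1 lies outside [J], hence outside the
    support of g. Both flatness and the absence of wrap-around follow. *)
Lemma test_zero (y s : R) : - eps < s < eps -> cis (y + s) = -1 :> C -> F y = 0.
Proof.
move=> seps ys; apply/eqP/negPn/negP => gy.
have Jy : J (e_i y) by have [_ _ gJ] := g_test; apply: gJ;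
  exact: subset_closure.
have := rot_J seps (ex_intro2 _ _ _ Jy erefl).
by rewrite -e_iD /cut_circle /= ys eqxx.
Qed.

Lemma test_flat : flat eps (fun x => complex.Re (F x)) /\
  flat eps (fun x => complex.Im (F x)).
Proof.
have F0 x : `|x - pi| < eps \/ `|x + pi| < eps -> F x = 0.
  case; rewrite ltr_norml => /andP [h1 h2].
    apply: (@test_zero _ (pi - x)); first lra.
    by rewrite addrC subrK cis_pi.
  apply: (@test_zero _ (- pi - x)); first lra.
  by rewrite addrC subrK cis_Npi.
by split=> x /F0 ->.
Qed.

Lemma test_dS1 x : dS1 g (e_i x) =
  derive1 (fun y => complex.Re (F y)) x +i*
    derive1 (fun y => complex.Im (F y)) x.
Proof.
have [su sv] := test_smooth.
have dshift (u : R -> R) : smooth u ->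
  derive1 (fun t => u (x + t)) 0 = derive1 u x.
  move=> /smooth_derivable du.
  have hu : is_derive (x + 0) (1 : R) u (derive1 u x).
    by rewrite addr0 derive1E; apply: DeriveDef.
  have hs : is_derive 0 (1 : R) (fun t : R => x + t) 1.
    have := is_deriveD (is_derive_cst x 0 (1 : R)) (is_derive_id 0 (1 : R)).
    by rewrite add0r.
  have [_ e] := @is_derive1_comp R u (fun t => x + t) 0 _ _ hu hs.
  by rewrite derive1E e mulr1.
rewrite -(dshift _ su) -(dshift _ sv) /dS1.
have rE : (fun t : R => g (rotS1 t (e_i x))) = (fun t => g (e_i (x + t))).
  by apply/funext => t; rewrite e_iD.
congr (_ +i* _).
  by have /(congr1 (fun f => derive1 (fun t => complex.Re (f t)) 0)) := rE.
by have /(congr1 (fun f => derive1 (fun t => complex.Im (f t)) 0)) := rE.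
Qed.

Lemma hat_commutator (D s : R) :
  hat (fun x => D%:C * g (e_i x) + (0 +i* 1) * dS1 g (e_i x)) s =
  (D - s)%:C * hat F s.
Proof.
have [su sv] := test_smooth; have [fu fv] := test_flat.
rewrite -(@hat_derive R (fun x => g (e_i x)) s eps D eps0 su sv fu fv).
congr (hat _ s); apply/funext => x; by rewrite test_dS1.
Qed.

Lemma commutator_ccont (D : R) :
  ccont (fun x => D%:C * g (e_i x) + (0 +i* 1) * dS1 g (e_i x)).
Proof.
have [su sv] := test_smooth.
have uc := smooth_cont su; have vc := smooth_cont sv.
have u'c := smooth_cont (smooth_derive su); have v'c := smooth_cont
  (smooth_derive sv).
split.
  rewrite (_ : (fun x => _) = (fun x => D * complex.Re (F x) +
    (-1) * derive1 (fun y => complex.Im (F y)) x)).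
    by apply: contD; exact: contZ.
  by apply/funext => x; rewrite test_dS1; case: (g _) => a b /=; ring.
rewrite (_ : (fun x => _) = (fun x => D * complex.Im (F x) +
  1 * derive1 (fun y => complex.Re (F y)) x)).
  by apply: contD; exact: contZ.
by apply/funext => x; rewrite test_dS1; case: (g _) => a b /=; ring.
Qed.

Lemma rot_ccont (t : R) : ccont (fun x => rot_fun t g (e_i x)).
Proof.
have [uc vc] := test_ccont; rewrite /rot_fun.
have -> : (fun x => g (rotS1 (- t) (e_i x))) = (fun x => g (e_i (x - t))).
  by apply/funext => x; rewrite e_iD.
split; [exact: (cont_shift (t := t) uc)|exact: (cont_shift (t := t) vc)].
Qed.

Lemma hat_rot (a : C) (t s : R) : - eps < t < eps ->
  hat (fun x => a * rot_fun t g (e_i x)) s = a * cis (- (s * t)) * hat F s.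
Proof.
move=> teps; rewrite hatZ; last exact: rot_ccont.
rewrite -mulrA; congr (_ * _).
have te : `|t| < eps by rewrite ltr_norml.
rewrite -(@hat_shift _ F) //; last 2 first.
- move=> y hy; apply: (@test_zero _ (pi - y));
  last by rewrite addrC subrK cis_pi.
  lra.
- move=> y hy; apply: (@test_zero _ (- pi - y));
  last by rewrite addrC subrK cis_Npi.
  lra.
- by congr (hat _ s); apply/funext => x; rewrite e_iD.
- exact: test_ccont.
Qed.

End TestFunctions.

Lemma powR_le_nat (R : realType) (a r : R) : 1 <= a -> 0 <= r ->
  a `^ r <= a ^+ (Num.truncn r).+1.
Proof.
move=> a1 r0; rewrite -powR_mulrn; last by apply: le_trans a1.
by rewrite ler_powR // ltW // truncnS_gt.
Qed.

Section SmearedForm.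
Context (R : realType) (V : unitary_voa R) (Wi Wj Wk : unitary_module V).
Context (Y : intertwiner Wi Wj Wk) (Hj : completion Wj) (Hk : completion Wk).
Local Notation C := R[i].
Variables (w : Wi) (D : R).
Hypothesis w_wt : mwt D w.
Implicit Types (h : R -> C) (v : Wj) (u : Wk).

(** Between weight vectors a single mode contributes. Finite support makes the sum over all real s a
    genuine one rather than the default 0. *)
Lemma iop_support v u : exists l : seq R,
  forall s, s \notin l -> um_ip Wk (Y w s v) u = 0.
Proof.
have Yr s : linear (Y w s) := (iop_bilinear Y).2 w s.
elim/mwt_ind: v => [|v1 v2 [l1 h1] [l2 h2]|la v vla].
- by exists [::] => s _; rewrite (lin0 (Yr s)) dot0l.
- exists (l1 ++ l2) => s; rewrite mem_cat negb_or => /andP [s1 s2].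
  by rewrite (linD (Yr s)) dotDl h1 // h2 // addr0.
elim/mwt_ind: u => [|u1 u2 [l1 h1] [l2 h2]|mu u umu].
- by exists [::] => s _; rewrite dot0r.
- exists (l1 ++ l2) => s; rewrite mem_cat negb_or => /andP [s1 s2].
  by rewrite dotDr h1 // h2 // addr0.
exists [:: la + D - 1 - mu] => s; rewrite inE => sl.
apply: mwt_orth (mwt_iop Y s w_wt vla) umu _; apply: contra sl => /eqP <-.
by apply/eqP; ring.
Qed.

(** The matrix entries depend on the test function only through its Fourier coefficients [h], so
    identities between smeared operators reduce to identities between coefficients. *)
Definition smeared_form h v u : C :=
  \sum_(s \in [set: R]) um_ip Wk (Y w s v) u * h s.

Lemma smeared_form_seq h v u (l : seq R) : uniq l ->
  (forall s, s \notin l -> um_ip Wk (Y w s v) u = 0) ->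
  smeared_form h v u = \sum_(s <- l) um_ip Wk (Y w s v) u * h s.
Proof.
move=> l_uniq l0; rewrite fsbig_seq //; apply/esym/fsbig_widen =>
  // s /= [_ sl].
by rewrite l0 ?mul0r //; apply/negP.
Qed.

Lemma smeared_form_mwt h la mu v u : mwt la v -> mwt mu u ->
  smeared_form h v u =
  um_ip Wk (Y w (la + D - 1 - mu) v) u * h (la + D - 1 - mu).
Proof.
move=> vla umu; rewrite (@smeared_form_seq _ _ _ [:: la + D - 1 - mu])
  ?big_seq1 //.
move=> s; rewrite inE => sl.
apply: mwt_orth (mwt_iop Y s w_wt vla) umu _; apply: contra sl => /eqP <-.
by apply/eqP; ring.
Qed.

Lemma smeared_form_l h u a v v' :
  smeared_form h (a *: v + v') u = a * smeared_form h v u + smeared_form h v' u.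
Proof.
have [l1 h1] := iop_support v u; have [l2 h2] := iop_support v' u.
have Yr s : linear (Y w s) := (iop_bilinear Y).2 w s.
have YE s : um_ip Wk (Y w s (a *: v + v')) u =
    a * um_ip Wk (Y w s v) u + um_ip Wk (Y w s v') u.
  by rewrite (Yr s) dotDl dotZl.
pose l := undup (l1 ++ l2); have lu : uniq l := undup_uniq _.
have l1l s : s \notin l -> um_ip Wk (Y w s v) u = 0.
  by rewrite mem_undup mem_cat negb_or => /andP [/h1].
have l2l s : s \notin l -> um_ip Wk (Y w s v') u = 0.
  by rewrite mem_undup mem_cat negb_or => /andP [_ /h2].
rewrite !(@smeared_form_seq _ _ _ l) //; last first.
  by move=> s sl; rewrite YE l1l // l2l // mulr0 addr0.
rewrite mulr_sumr -big_split /=; apply: eq_bigr => s _.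
by rewrite YE mulrDl mulrA.
Qed.

Lemma smeared_form_r h v a u u' :
  smeared_form h v (a *: u + u') = Num.conj a * smeared_form h v u +
    smeared_form h v u'.
Proof.
have [l1 h1] := iop_support v u; have [l2 h2] := iop_support v u'.
pose l := undup (l1 ++ l2); have lu : uniq l := undup_uniq _.
have l1l s : s \notin l -> um_ip Wk (Y w s v) u = 0.
  by rewrite mem_undup mem_cat negb_or => /andP [/h1].
have l2l s : s \notin l -> um_ip Wk (Y w s v) u' = 0.
  by rewrite mem_undup mem_cat negb_or => /andP [_ /h2].
rewrite !(@smeared_form_seq _ _ _ l) //; last first.
  by move=> s sl; rewrite dotDr dotZr l1l // l2l // mulr0 addr0.
rewrite mulr_sumr -big_split /=; apply: eq_bigr => s _.
by rewrite dotDr dotZr mulrDl mulrA.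
Qed.

Lemma smeared_form_integral F v u : ccont F ->
  cintegral (- pi) pi (fun x =>
    correlation Y w v u x * F x * (cis x / (2 * pi)%:C)) =
  smeared_form (hat F) v u.
Proof.
move=> Fc; have [l0 h0] := iop_support v u.
pose l := undup l0; have lu : uniq l := undup_uniq _.
have l0l s : s \notin l -> um_ip Wk (Y w s v) u = 0 by rewrite mem_undup;
  exact: h0.
rewrite (smeared_form_seq _ lu l0l).
have -> : (fun x => correlation Y w v u x * F x * (cis x / (2 * pi)%:C)) =
    (fun x => \sum_(s <- l) um_ip Wk (Y w s v) u * kern F s x).
  apply/funext => x.
  have -> : correlation Y w v u x =
      \sum_(s <- l) um_ip Wk (Y w s v) u * cis (x * (- s - 1)).
    rewrite fsbig_seq //; apply/esym/fsbig_widen => // s /= [_ sl].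
    by rewrite l0l ?mul0r //; apply/negP.
  by rewrite !mulr_suml; apply: eq_bigr => s _; rewrite /kern !mulrA.
(* Continuity is carried along the induction because linearity of the integral requires it. *)
suff [] : ccont (fun x => \sum_(s <- l) um_ip Wk (Y w s v) u * kern F s x) /\
  cintegral (- pi) pi (fun x => \sum_(s <- l) um_ip Wk (Y w s v) u * kern F s
    x) =
  \sum_(s <- l) um_ip Wk (Y w s v) u * hat F s by [].
elim: (l) => [|s r [rc rE]].
  have -> : (fun x => \sum_(s <- [::]) um_ip Wk (Y w s v) u * kern F s x) =
    (fun=> 0).
    by apply/funext => x; rewrite big_nil.
  split; first by split=> x; exact: cvg_cst.
  by rewrite big_nil /cintegral /= Rintegral_cst // mul0r.
have kc := kern_cont s Fc.
have -> : (fun x => \sum_(t <- s :: r) um_ip Wk (Y w t v) u * kern F t x) =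
    (fun x => um_ip Wk (Y w s v) u * kern F s x +
              \sum_(t <- r) um_ip Wk (Y w t v) u * kern F t x).
  by apply/funext => x; rewrite big_cons.
split; last by rewrite cintegral_lin // rE big_cons.
exact: ccont_lin.
Qed.

Hypothesis Y_bounded : energy_bounded Y Hj Hk w.

Lemma iop_bound : exists (M : R) (n m : nat), 0 <= M /\
  forall la s v, 0 <= la -> mwt la v ->
  nrW Hk (Y w s v) <= M * (1 + `|s|) ^+ n * (1 + la) ^+ m * nrW Hj v.
Proof.
have [M [r [t [M0 r0 t0 YM]]]] := Y_bounded.
exists M, (Num.truncn t).+1, (Num.truncn r).+1; split=> // la s v la0 vla.
have [->|v0] := eqVneq v 0.
  by rewrite (lin0 ((iop_bilinear Y).2 w s)) /nrW !linear0 !nr0 mulr0.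
have := YM s v; rewrite (sobolev_norm_mwt Hj r vla v0) nrE -realcM lecR =>
  /le_trans.
apply; rewrite mulrA ler_wpM2r ?nr_ge0 //.
have s1 : 1 <= 1 + `|s| by rewrite lerDl.
have l1 : 1 <= 1 + la by rewrite lerDl.
apply: ler_pM; rewrite ?mulr_ge0 ?powR_ge0 //; last exact: powR_le_nat.
by apply: ler_wpM2l => //; exact: powR_le_nat.
Qed.

Definition rapid h := forall n : nat, exists2 k : R, 0 <= k &
  forall s, nr (h s) * (1 + `|s|) ^+ n <= k.

(** The contributing mode is s = la + D - 1 - mu, so the two weights differ by at most |s| + |D -
    1|; [c] accounts for the second term. *)
Let c := 1 + `|D - 1|.

Let c_ge0 : 0 <= c.
Proof. by rewrite addr_ge0. Qed.

Let weight_le (la mu : R) : 0 <= la -> 0 <= mu ->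
  1 + mu <= c * (1 + `|la + D - 1 - mu|) * (1 + la) /\
  1 + la <= c * (1 + `|la + D - 1 - mu|) * (1 + mu).
Proof.
move=> la0 mu0; rewrite /c; set s := la + D - 1 - mu; set d := D - 1.
have sE : s = la + d - mu by rewrite /s /d; ring.
have d1 := ler_norm d; have d2 := ler_norm (- d); rewrite normrN in d2.
have s1 := ler_norm s; have s2 := ler_norm (- s); rewrite normrN in s2.
have d0 := normr_ge0 d; have s0 := normr_ge0 s.
have ds := mulr_ge0 d0 s0; have dsl := mulr_ge0 ds la0;
  have dsm := mulr_ge0 ds mu0.
have dl := mulr_ge0 d0 la0; have sl := mulr_ge0 s0 la0.
have dm := mulr_ge0 d0 mu0; have sm := mulr_ge0 s0 mu0.
split.
  have -> : (1 + `|d|) * (1 + `|s|) * (1 + la) = 1 + la + `|d| + `|s| + `|d| *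
    `|s|
     + `|d| * la + `|s| * la + `|d| * `|s| * la by ring.
  by lra.
have -> : (1 + `|d|) * (1 + `|s|) * (1 + mu) = 1 + mu + `|d| + `|s| + `|d| *
  `|s|
   + `|d| * mu + `|s| * mu + `|d| * `|s| * mu by ring.
by lra.
Qed.

(** The exponent [m] is fixed before [n], which [smeared_form_decayj] relies on. The growth of the
    modes in s costs [n0] powers of the decay of [h]. *)
Lemma smeared_form_bound h : rapid h -> exists (m : nat), forall n : nat,
  exists2 k : R, 0 <= k &
  forall la mu v u, 0 <= la -> 0 <= mu -> mwt la v -> mwt mu u ->
  nr (smeared_form h v u) * (1 + `|la + D - 1 - mu|) ^+ n <=
  k * (1 + la) ^+ m * nrW Hj v * nrW Hk u.
Proof.
move=> hr; have [M [n0 [m [M0 YM]]]] := iop_bound; exists m => n.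
have [k k0 kP] := hr (n0 + n)%N; exists (k * M); first exact: mulr_ge0.
move=> la mu v u la0 mu0 vla umu; rewrite (smeared_form_mwt h vla umu).
set s := la + D - 1 - mu; rewrite nrM.
have s0 : 0 <= 1 + `|s| by rewrite addr_ge0.
have l0 : 0 <= 1 + la by rewrite addr_ge0.
have h1 : nr (um_ip Wk (Y w s v) u) <=
    M * (1 + `|s|) ^+ n0 * (1 + la) ^+ m * nrW Hj v * nrW Hk u.
  apply: le_trans (um_CS Hk _ _) _.
  by apply: ler_wpM2r (YM la s v la0 vla); exact: nr_ge0.
have -> : k * M * (1 + la) ^+ m * nrW Hj v * nrW Hk u =
    (M * (1 + la) ^+ m * nrW Hj v * nrW Hk u) * k by ring.
apply: le_trans (ler_wpM2l _ (kP s)); last first.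
  by rewrite !mulr_ge0 ?exprn_ge0 ?nr_ge0.
have -> : (M * (1 + la) ^+ m * nrW Hj v * nrW Hk u) * (nr (h s) * (1 + `|s|)
  ^+ (n0 + n)) =
   (M * (1 + `|s|) ^+ n0 * (1 + la) ^+ m * nrW Hj v * nrW Hk u) * (nr (h s) *
     (1 + `|s|) ^+ n).
  by rewrite exprD; ring.
by rewrite -mulrA; apply: ler_wpM2r h1; rewrite mulr_ge0 ?nr_ge0 ?exprn_ge0.
Qed.

Lemma smeared_form_decayk h : rapid h -> forall p : nat,
  exists (k : R) (n : nat), 0 <= k /\
  forall (la mu : R) v u, 0 <= la -> 0 <= mu -> mwt la v -> mwt mu u ->
  nr (smeared_form h v u) * (1 + mu) ^+ p <= k * (1 + la) ^+ n * nrW Hj v *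
    nrW Hk u.
Proof.
move=> hr p; have [m /(_ p) [k k0 kP]] := smeared_form_bound hr.
exists (c ^+ p * k), (m + p)%N; split; first by rewrite mulr_ge0 ?exprn_ge0.
move=> la mu v u la0 mu0 vla umu; have [w1 _] := weight_le la0 mu0.
have l0 : 0 <= 1 + la by rewrite addr_ge0.
have m0 : 0 <= 1 + mu by rewrite addr_ge0.
set s := la + D - 1 - mu in w1 kP *.
have s0 : 0 <= 1 + `|s| by rewrite addr_ge0.
apply: (@le_trans _ _ (nr (smeared_form h v u) * (c * (1 + `|s|) * (1 + la))
  ^+ p)).
  apply: ler_wpM2l; first exact: nr_ge0.
  by rewrite lerXn2r ?nnegrE ?mulr_ge0.
have -> : nr (smeared_form h v u) * (c * (1 + `|s|) * (1 + la)) ^+ p =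
   (c ^+ p * (1 + la) ^+ p) * (nr (smeared_form h v u) * (1 + `|s|) ^+ p).
  by rewrite !exprMn; ring.
have -> : c ^+ p * k * (1 + la) ^+ (m + p) * nrW Hj v * nrW Hk u =
   (c ^+ p * (1 + la) ^+ p) * (k * (1 + la) ^+ m * nrW Hj v * nrW Hk u).
  by rewrite exprD; ring.
apply: ler_wpM2l; first by rewrite mulr_ge0 ?exprn_ge0.
exact: kP.
Qed.

Lemma smeared_form_decayj h : rapid h -> forall p : nat,
  exists (k : R) (n : nat), 0 <= k /\
  forall (la mu : R) v u, 0 <= la -> 0 <= mu -> mwt la v -> mwt mu u ->
  nr (smeared_form h v u) * (1 + la) ^+ p <= k * (1 + mu) ^+ n * nrW Hj v *
    nrW Hk u.
Proof.
move=> hr p; have [m mP] := smeared_form_bound hr.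
have [k k0 kP] := mP (p + m)%N.
exists (c ^+ (p + m) * k), (p + m)%N; split; first by rewrite mulr_ge0
  ?exprn_ge0.
move=> la mu v u la0 mu0 vla umu; have [_ w1] := weight_le la0 mu0.
have l0 : 0 < 1 + la by lra.
have m0 : 0 <= 1 + mu by rewrite addr_ge0.
have := kP la mu v u la0 mu0 vla umu.
set s := la + D - 1 - mu in w1 *; move=> kPs.
have s0 : 0 <= 1 + `|s| by rewrite addr_ge0.
have lm : 0 < (1 + la) ^+ m by rewrite exprn_gt0.
(* Decay in [la] must also beat the growth (1 + la)^m from the energy bound, so p + m powers are
   traded for powers of 1 + |s| and 1 + mu. *)
rewrite -(ler_pM2r lm) -[X in X <= _]mulrA -exprD.
apply: (@le_trans _ _ (nr (smeared_form h v u) * (c * (1 + `|s|) * (1 + mu))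
  ^+ (p + m))).
  apply: ler_wpM2l; first exact: nr_ge0.
  by rewrite lerXn2r ?nnegrE ?mulr_ge0 // ltW.
have -> : nr (smeared_form h v u) * (c * (1 + `|s|) * (1 + mu)) ^+ (p + m) =
   (c ^+ (p + m) * (1 + mu) ^+ (p + m)) *
   (nr (smeared_form h v u) * (1 + `|s|) ^+ (p + m)).
  by rewrite !exprMn; ring.
have -> : c ^+ (p + m) * k * (1 + mu) ^+ (p + m) * nrW Hj v * nrW Hk u * (1 +
  la) ^+ m =
   (c ^+ (p + m) * (1 + mu) ^+ (p + m)) * (k * (1 + la) ^+ m * nrW Hj v * nrW
     Hk u).
  by ring.
apply: ler_wpM2l => //; by rewrite mulr_ge0 ?exprn_ge0.
Qed.

Hypothesis minj : finite_set (minw Wj).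
Hypothesis mink : finite_set (minw Wk).

Lemma smeared_adjoint (g : S1 R -> C) : ccont (fun x => g (e_i x)) ->
  rapid (hat (fun x => g (e_i x))) -> exists a : Wk -> Hj,
  (forall v u, hc_ip Hj (hc_in Hj v) (a u) =
    smeared_form (hat (fun x => g (e_i x))) v u) /\
  forall x, smooth_vectors Hj x -> exists y,
    [/\ smooth_vectors Hk y, forall u, hc_ip Hk y (hc_in Hk u) = hc_ip Hj x (a
      u) &
      forall z, smeared Y Hj Hk w g (x, z) <-> z = y].
Proof.
move=> gc gr; set h := hat _ in gr *.
have graphE : smeared_alg Y (Hj := Hj) (Hk := Hk) w g = form_graph
  (smeared_form h).
  apply/seteqP; split=> [p [v [pv pE]]|p [v [pv pE]]]; exists v; split=> // u.
    by rewrite pE (smeared_form_integral v u gc).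
  by rewrite pE (smeared_form_integral v u gc).
have [a [aE aP]] := form_graph_closure minj mink (smeared_form_l h)
  (smeared_form_r h)
  (smeared_form_decayk gr) (smeared_form_decayj gr).
exists a; split=> // x /aP [y [ys yE yP]]; exists y; split=> // z.
by rewrite /smeared graphE; exact: yP.
Qed.

End SmearedForm.

(** * Functions of the energy on smooth vectors, and the two identities *)

Section SmoothFunctions.
Context (R : realType) (V : unitary_voa R) (W : unitary_module V).
Context (H : completion W).
Local Notation C := R[i].
Hypothesis minw_fin : finite_set (minw W).

(** Applied below to f(s) = s and f(s) = e^(-its), so that the inner operators in both identities
    keep vectors smooth. *)
Lemma smooth_fun (f : R -> C) (m : nat) (x : H) :
  (forall s, 0 <= s -> nr (f s) <= (1 + s) ^+ m) -> smooth_vectors H x ->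
  exists2 y, smooth_vectors H y & wk_rel f x y.
Proof.
move=> fm /(smooth_wk minw_fin) xs.
have wk_f p : exists y, wk_rel (fun s => ((1 + s) ^+ p)%:C * f s) x y.
  have [z xz] := xs (p + m + 2)%N.
  apply: (@wk_fun _ _ _ _ minw_fin _ 1 _ _ _ xz) => s s0.
  have s1 : 0 <= 1 + s by lra.
  rewrite nrM nr_real ger0_norm ?exprn_ge0 // mul1r !exprD.
  apply: ler_wpM2r; first exact: exprn_ge0.
  by apply: ler_wpM2l; [exact: exprn_ge0|exact: fm].
have [y xy] := wk_f 0%N.
have {}xy : wk_rel f x y.
  by apply: wk_rel_eq xy => s _; rewrite expr0 mul1r.
exists y => //; apply/(smooth_wk minw_fin) => p; have [z xz] := wk_f p.
by exists z => s v vs; rewrite (xz s) // (xy s) // mulrA.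
Qed.

End SmoothFunctions.

Theorem proposition3p15 (R : realType) (V : unitary_voa R)
    (V_cft : cft_type V) (V_C2 : C2_cofinite V)
    (V_rational : forall M : weak_module V,
       N_gradable M -> completely_reducible M)
    (Wi Wj Wk : unitary_module V)
    (Hj : completion Wj) (Hk : completion Wk)
    (Y : intertwiner Wi Wj Wk)
    (w : Wi) (Delta : R) (w_wt : mwt Delta w)
    (Y_bounded : energy_bounded Y Hj Hk w)
    (J : set (S1 R)) (J_arc : open_arc J) (J_cut : J `<=` @cut_circle R)
    (eps : R) (eps_gt0 : 0 < eps)
    (rot_J : forall s : R, - eps < s < eps -> rotS1 s @` J `<=` @cut_circle R)
    (g : S1 R -> R[i]) (g_test : test_fun J g)
    (t : R) (t_eps : - eps < t < eps) :
  eq_on (smooth_vectors Hj)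
    (op_sub (op_comp (L0cl Hk) (smeared Y Hj Hk w g))
            (op_comp (smeared Y Hj Hk w g) (L0cl Hj)))
    (smeared Y Hj Hk w
       (fun z => (Delta - 1)%:C * g z + (0 +i* 1) * dS1 g z))
  /\
  eq_on (smooth_vectors Hj)
    (op_comp (L0exp Hk t) (op_comp (smeared Y Hj Hk w g) (L0exp Hj (- t))))
    (smeared Y Hj Hk w
       (fun z => cis ((Delta - 1) * t) * rot_fun t g z)).
Proof.
have minj : finite_set (minw Wj) by exact: minw_finite.
have mink : finite_set (minw Wk) by exact: minw_finite.
pose h := hat (fun x => g (e_i x)).
have h_rapid : rapid h.
  have [su sv] := test_smooth g_test; have [fu fv] := test_flat rot_J g_test.
  by move=> n; exact: hat_decay eps_gt0 su sv fu fv.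
have [a [aE aP]] := smeared_adjoint w_wt Y_bounded minj mink (test_ccont
  g_test) h_rapid.
have conj_real (k : R) : Num.conj (k%:C : R[i]) = k%:C by exact: conjc_real.
split=> x xs.
- set g1 := fun z => _ + _.
  have h1E s : hat (fun x => g1 (e_i x)) s = (Delta - 1 - s)%:C * h s.
    exact: (hat_commutator eps_gt0 rot_J g_test).
  have h1_rapid : rapid (hat (fun x => g1 (e_i x))).
    (* The factor Delta - 1 - s costs one power of 1 + |s|. *)
    move=> n; have [k k0 kP] := h_rapid n.+1.
    exists (k * (1 + `|Delta - 1|)); first by rewrite mulr_ge0 ?addr_ge0.
    move=> s; rewrite h1E nrM nr_real.
    have s0 : 0 <= 1 + `|s| by rewrite addr_ge0.
    have hs := mulr_ge0 (nr_ge0 (h s)) (exprn_ge0 n s0).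
    have : `|Delta - 1 - s| <= (1 + `|Delta - 1|) * (1 + `|s|).
      apply: le_trans (ler_normB _ _) _.
      have := mulr_ge0 (normr_ge0 (Delta - 1)) (normr_ge0 s); lra.
    move=> /(ler_wpM2r hs); rewrite mulrA => /le_trans; apply.
    have -> : (1 + `|Delta - 1|) * (1 + `|s|) * (nr (h s) * (1 + `|s|) ^+ n) =
       (nr (h s) * (1 + `|s|) ^+ n.+1) * (1 + `|Delta - 1|) by rewrite exprS;
         ring.
    by rewrite ler_wpM2r // addr_ge0.
  have [a1 [a1E a1P]] := smeared_adjoint w_wt Y_bounded minj mink
    (commutator_ccont g_test (Delta - 1)) h1_rapid.
  have [y [ys yE yP]] := aP x xs; have [y1 [y1s y1E y1P]] := a1P x xs.
  have [|x' x's xx'] := @smooth_fun _ _ _ _ minj (fun s => s%:C) 1 x _ xs.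
    by move=> s s0; rewrite nr_real ger0_norm // expr1; lra.
  have [y' [y's y'E y'P]] := aP x' x's.
  (* Here y, y1 and y' are the images of x under the operator for g, of x under that for [g1], and
     of L_0 x under that for g. *)
  have comm : wk_rel (fun s => s%:C) y (y1 + y').
    move=> mu u umu; rewrite dotDl y1E y'E.
    (* L_0 passes from x to the adjoint vectors: between weights la and mu, the factor la is mu -
       (mu - la), and mu - la is the coefficient ratio of [g1] to g. *)
    have -> : hc_ip Hj x' (a u) = hc_ip Hj x (a (vir 0 u) - a1 u).
      apply: (wk_adjoint xx') => la v vla; rewrite dotBr !aE a1E.
      rewrite (mwt_L0 umu) -[mu%:C *: u]addr0 (smeared_form_r Y w_wt).
      rewrite (smeared_form_mwt Y w_wt _ vla (mwt0 Wk mu)) //.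
      rewrite !(smeared_form_mwt Y w_wt _ vla umu) // dot0r mul0r addr0 h1E.
      have -> : Delta - 1 - (la + Delta - 1 - mu) = mu - la by ring.
      have -> : (mu - la)%:C = mu%:C - la%:C by exact: (rmorphB (real_complex
        R)).
      by rewrite conj_real -/h; ring.
    by rewrite dotBr addrC subrK -yE (mwt_L0 umu) linearZ dotZr conj_real.
  (* Both graphs take exactly the value [y1] at x: uniqueness comes from [wk_rel_inj], and
     membership in the composed domains from [comm] and the smoothness of [x']. *)
  exists y1; split; apply/seteqP; split=> z /=.
  + move=> [p [q [[p' [/yP -> /L0cl_wk /= yp]] [q' [/L0cl_wk /= xq' q'q]] ->]]].
    have qE := wk_rel_inj xq' xx'; rewrite qE in q'q.
    have /y'P -> := q'q.
    by rewrite (wk_rel_inj yp comm) addrK.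
  + move=> ->; exists (y1 + y'), y'; split; last by rewrite addrK.
      by exists y; split; [exact/yP|exact/L0cl_wk].
    by exists x'; split; [exact/L0cl_wk|exact/y'P].
  + by move/y1P.
  + by move=> ->; exact/y1P.
- set gt := fun z => _ * _.
  have htE s : hat (fun x => gt (e_i x)) s = cis (t * (Delta - 1 - s)) * h s.
    rewrite /gt (hat_rot rot_J g_test) // -cisD.
    by congr (cis _ * _); ring.
  have nr_cis k : nr (cis k : R[i]) = 1 by rewrite /nr cis_norm.
  have ht_rapid : rapid (hat (fun x => gt (e_i x))).
    move=> n; have [k k0 kP] := h_rapid n; exists k => // s.
    by rewrite htE nrM nr_cis mul1r.
  have gt_ccont : ccont (fun x => gt (e_i x)).
    have c0 : ccont (fun=> 0 : R[i]) by split=> z; exact: cvg_cst.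
    have := ccont_lin (cis ((Delta - 1) * t)) (rot_ccont g_test t) c0.
    by under eq_fun do rewrite addr0.
  have [a1 [a1E a1P]] := smeared_adjoint w_wt Y_bounded minj mink gt_ccont
    ht_rapid.
  have [yt [yts ytE ytP]] := a1P x xs.
  have [|x' x's xx'] := @smooth_fun _ _ _ _ minj (fun s =>
    cis (- t * s)) 0 x _ xs.
    by move=> s _; rewrite nr_cis.
  have [y' [y's y'E y'P]] := aP x' x's.
  have conj_cis k : Num.conj (cis k : R[i]) = cis (- k).
    by rewrite /cis cosN sinN.
  have rot : wk_rel (fun s => cis (t * s)) y' yt.
    move=> mu u umu; rewrite ytE y'E.
    (* The phase e^(-it la) is e^(-it mu) times e^(it(mu - la)); the second factor is the
       coefficient ratio of [gt] to g, and the first is undone by the outer exponential. *)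
    have -> : hc_ip Hj x' (a u) = hc_ip Hj x (cis (t * mu) *: a1 u).
      apply: (wk_adjoint xx') => la v vla; rewrite dotZr !aE a1E.
      rewrite !(smeared_form_mwt Y w_wt _ vla umu) // htE conj_cis.
      have -> : - t * la = - (t * mu) + t * (Delta - 1 - (la + Delta - 1 -
        mu)) by ring.
      by rewrite cisD -/h; ring.
    by rewrite dotZr conj_cis mulrA -cisD subrr /cis cos0 sin0 mul1r.
  exists yt; split; apply/seteqP; split=> z /=.
  + move=> [p [[q [/op_fun_wk /= xq q'q]] /op_fun_wk /= pz]].
    have qE := wk_rel_inj xq xx'; rewrite qE in q'q.
    have /y'P pE := q'q; rewrite pE in pz.
    exact: wk_rel_inj pz rot.
  + move=> ->; exists y'; split; last exact/op_fun_wk.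
    by exists x'; split; [exact/op_fun_wk|exact/y'P].
  + by move/ytP.
  + by move=> ->; exact/ytP.
Qed.
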